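(* For any function $u\in\mathrm H^1(\mathbb R^2)$, $u\not\equiv0$, we have $$2\,\pi\int_{\mathbb R^2}|u|^2\,(-\Delta)^{-1}|u|^2\,dx\le\|u\|_{2}^4\,\log\left(\frac{\|\nabla u\|_{2}}{\|u\|_{2}}\right),$$ where $$2\,\pi\int_{\mathbb R^2}|u|^2\,(-\Delta)^{-1}|u|^2\,dx=-\iint_{\mathbb R^2\times\mathbb R^2}|u(x)|^2\,\log|x-y|\,|u(y)|^2\,dx\,dy\,.$$
   Context: $\|\cdot\|_2$ denotes the $\mathrm L^2(\mathbb R^2)$ norm, $\mathrm H^1(\mathbb R^2)$ is the usual Sobolev space, and $\log$ is the natural logarithm. The operator $(-\Delta)^{-1}$ is given by the Green kernel on $\mathbb R^2$: $(-\Delta)^{-1}\rho(x)=-\frac1{2\pi}\int_{\mathbb R^2}\log|x-y|\,\rho(y)\,dy$. *)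

(* Defs.v *)
From HB Require Import structures.
From mathcomp Require Import all_boot all_order all_algebra.
From mathcomp Require Import all_classical all_reals all_analysis.
From mathcomp Require Import complex.
Set Implicit Arguments.
Unset Strict Implicit.
Unset Printing Implicit Defensive.
Import Order.TTheory GRing.Theory Num.Theory numFieldNormedType.Exports.
Local Open Scope classical_set_scope.
Local Open Scope ring_scope.

Definition lebesgue2 (R : realType) :
    set (measurableTypeR R * measurableTypeR R) -> \bar R :=
  (@lebesgue_measure R \x @lebesgue_measure R)%E.

(* The library's sigma-finite instance on [m1 \x m2] is shadowed by the one for
   subprobabilities, hence the instance on this constant. *)

Section lebesgue2_sigma_finite.
Variable R : realType.

HB.instance Definition _ := Measure.on (@lebesgue2 R).

Let lebesgue2_sigma_finite : sigma_finite setT (@lebesgue2 R).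
Proof.
have /sigma_finiteP[F [TF ndF Foo]] := sigma_finiteT (@lebesgue_measure R).
exists (fun n => F n `*` F n).
  rewrite -setXTT TF predeqE => -[x y]; split.
    move=> [/= [n _ Fnx] [k _ Gky]]; exists (maxn n k) => //; split.
    - by move: x Fnx; exact/subsetPset/ndF/leq_maxl.
    - by move: y Gky; exact/subsetPset/ndF/leq_maxr.
  by move=> [n _ []/= ? ?]; split; exists n.
move=> k; have [? ?] := Foo k.
split; first exact: measurableX.
by rewrite /lebesgue2 product_measure1E// lte_mul_pinfty// ge0_fin_numE.
Qed.

HB.instance Definition _ := Measure_isSigmaFinite.Build _ _ _
  (@lebesgue2 R) lebesgue2_sigma_finite.

End lebesgue2_sigma_finite.

Section sobolev.
Variable R : realType.
Local Notation mu := (@lebesgue2 R).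
Implicit Types (f g phi rho : R * R -> R) (u : R * R -> R[i]) (i : 'I_2).

(* The canonical norm on R * R is the max norm, not the Euclidean one. *)
Definition enorm (x : R * R) : R := Num.sqrt (x.1 ^+ 2 + x.2 ^+ 2).

Definition axis i : R * R := if val i == 0%N then (1, 0) else (0, 1).

Fixpoint Ck (k : nat) phi : Prop :=
  continuous phi /\
  if k is k'.+1 then
    forall i, (forall x, derivable phi x (axis i)) /\ Ck k' ('D_(axis i) phi)
  else True.

Definition test_function phi : Prop :=
  (forall k, Ck k phi) /\ compact (closure [set x | phi x != 0]).

Definition is_weak_partial i f g : Prop :=
  forall phi, test_function phi ->
    \int[mu]_x (f x * 'D_(axis i) phi x) = - \int[mu]_x (g x * phi x).

Definition L2_weak_partials i f : set (R * R -> R) :=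
  [set g | g \in Lfun mu 2%:E /\ is_weak_partial i f g].

Definition H1_real f : Prop :=
  f \in Lfun mu 2%:E /\ forall i, L2_weak_partials i f !=set0.

(* A choice of representative, unique up to a null set; 0 if there is none. *)
Definition weak_partial i f : R * R -> R :=
  xget (cst 0) (L2_weak_partials i f).

Definition H1 u : Prop :=
  H1_real (fun x => complex.Re (u x)) /\ H1_real (fun x => complex.Im (u x)).

Definition cabs2 (z : R[i]) : R := Normc.normc z ^+ 2.

Definition grad_abs u (x : R * R) : R :=
  Num.sqrt (\sum_(i < 2)
    cabs2 (weak_partial i (fun y => complex.Re (u y)) x +i*
           weak_partial i (fun y => complex.Im (u y)) x)%C).

Definition L2norm f : R := fine ('N[mu]_2[EFin \o f])%E.

(* Extended-real valued: the integral may be +oo when rho decays slowly. The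
   value [ln 0 = 0] is only used on the null set y = x. *)
Definition inv_neg_laplacian rho (x : R * R) : \bar R :=
  ((- (2 * pi)^-1)%:E * \int[mu]_y (ln (enorm (x - y)) * rho y)%:E)%E.

End sobolev.

(* Main.v *)
(* Let F be a bounded vector field on the plane with div F - |F|^2 >= 1/2 - ln |z|.
   Testing -Delta against F, as in a Hardy inequality, shows that
   -Delta + ln |z| >= 1/2. Let M = ||u||_2^2 and G = ||grad u||_2^2. In the
   two-particle state |u|(x) |u|(y), the relative coordinate z = x - y has kinetic
   energy at most M G / 2: shifting x and y by opposite vectors of length k moves
   z by 2 k. Thus, with rho = |u|^2, - int int rho(x) ln |x - y| rho(y) is at most
   M G / 2 - M^2 / 2, and, after scaling by l > 0, at most
   M G / (2 l^2) + M^2 (ln l - 1/2). The choice l^2 = G / M gives the theorem.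

   No integration by parts is needed: the kinetic energy enters only through
   ||u(. + k e_i) - u||_2 <= k ||partial_i u||_2, which passes from Re u and Im u
   to |u|, and div F through difference quotients and Fatou's lemma as k -> 0. *)

Require Import Defs.
From mathcomp Require Import all_boot all_order all_algebra.
From mathcomp Require Import all_classical all_reals all_analysis.
From mathcomp Require Import measurable_realfun.
From mathcomp Require Import complex.
From mathcomp Require Import ring lra.
Set Implicit Arguments.
Unset Strict Implicit.
Unset Printing Implicit Defensive.
Import Order.TTheory GRing.Theory Num.Theory numFieldNormedType.Exports.
Local Open Scope classical_set_scope.
Local Open Scope ring_scope.

(** For F = - grad psi / psi one has div F - |F|^2 = - Delta psi / psi, so the ideal field comes
    from the ground state psi of -Delta + ln |z|. That field is not explicit and is unbounded at
    infinity. A bounded one is wanted: with it the integrals of rho(x) rho(y) against F(x - y) and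
    |F(x - y)|^2 converge for every u in L^2, without moments or truncation. The substitute [prof]
    only has to satisfy an inequality. With t = |z|^(1/2) it is about 1 / (2 t) at 0, so that div F
    is about 3 / (4 t) and dominates - ln |z| = - 2 ln t; at infinity |F| tends to 5 / 3 and ln |z|
    absorbs - |F|^2. In between there is little room: at |z| = 1 the two sides differ by 1 / 72.

    The price is that F is not differentiable at the origin, hence the removal of the diagonal x =
    y. Moreover the positive part of rho(x) ln |x - y| rho(y) may have an infinite integral; only
    the negative part is controlled, so that exchanging the integrals takes more than Fubini's
    theorem. *)

(** * Rational lower bounds for the logarithm *)

Section logarithm_bounds.
Variable R : realType.
Implicit Types (t x : R).

Lemma is_derive_div (f g : R -> R) x a b :
  is_derive x 1 f a -> is_derive x 1 g b -> g x != 0 ->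
  is_derive x 1 (fun y => f y / g y) ((a * g x - f x * b) / g x ^+ 2).
Proof.
move=> fa gb gx0.
have dV := is_deriveV gx0 gb.
have := is_deriveM fa dV.
move/is_derive_eq; apply; rewrite /GRing.scale/=; field.
exact: gx0.
Qed.

(** The fraction is the [2/2] Pade approximant of ln at 1, so the derivative of the difference is a
    fourth power over a positive quantity. As it is positive on both sides of 1, the inequality
    reverses for t < 1, where another approximant is used. *)
Lemma ln_ge_pade t : 1 <= t ->
  3 * (t ^+ 2 - 1) / (t ^+ 2 + 4 * t + 1) <= ln t.
Proof.
move=> t1.
pose f t : R := ln t - 3 * (t ^+ 2 - 1) / (t ^+ 2 + 4 * t + 1).
have df x : 0 < x ->
    is_derive x 1 f ((x - 1) ^+ 4 / (x * (x ^+ 2 + 4 * x + 1) ^+ 2)).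
  move=> x0; have q0 : x ^+ 2 + 4 * x + 1 != 0 by rewrite gt_eqF//; nra.
  have dn : is_derive x 1 (fun t : R => 3 * (t ^+ 2 - 1)) (6 * x).
    by apply: is_derive_eq; rewrite /GRing.scale/=; ring.
  have dd : is_derive x 1 (fun t : R => t ^+ 2 + 4 * t + 1) (2 * x + 4).
    by apply: is_derive_eq; rewrite /GRing.scale/=; ring.
  have /is_derive_eq := is_deriveB (is_derive1_ln x0) (is_derive_div dn dd q0).
  apply; field; rewrite q0 gt_eqF//.
have : f 1 <= f t.
  apply: (@ger0_derive1_ndecry _ f 1) => //.
  - by move=> x /[!in_itv]/=/andP[x1 _]; have [] := df x (lt_trans ltr01 x1).
  - move=> x /[!in_itv]/=/andP[x1 _]; have x0 := lt_trans ltr01 x1.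
    rewrite derive1E; have [_ ->] := df x x0.
    by rewrite divr_ge0 ?exprn_even_ge0// mulr_ge0 ?sqr_ge0 ?ltW.
  - apply: continuous_in_subspaceT => x /[!inE]/=/[!in_itv]/=/andP[x1 _].
    apply: differentiable_continuous; apply/derivable1_diffP.
    by have [] := df x (lt_le_trans ltr01 x1).
by rewrite /f ln1 expr1n subrr mulr0 mul0r subrr subr_ge0.
Qed.

(** In the variable 1 / t the fraction is the [2/1] Pade approximant of ln at 1. The odd contact at
    1 gives the derivative of the difference the sign of (x - 1)^3. *)
Lemma ln_ge_pade_inv t : 0 < t <= 1 ->
  - ((1 - t) * (1 + 5 * t) / (2 * t * (2 + t))) <= ln t.
Proof.
move=> /andP[t0 t1].
pose f t : R := ln t + (1 - t) * (1 + 5 * t) / (2 * t * (2 + t)).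
have df x : 0 < x ->
    is_derive x 1 f ((x - 1) ^+ 3 / (x ^+ 2 * (2 + x) ^+ 2)).
  move=> x0; have q0 : 2 * x * (2 + x) != 0 by rewrite gt_eqF//; nra.
  have dn : is_derive x 1 (fun t : R => (1 - t) * (1 + 5 * t)) (4 - 10 * x).
    by apply: is_derive_eq; rewrite /GRing.scale/=; ring.
  have dd : is_derive x 1 (fun t : R => 2 * t * (2 + t)) (4 + 4 * x).
    by apply: is_derive_eq; rewrite /GRing.scale/=; ring.
  have /is_derive_eq := is_deriveD (is_derive1_ln x0) (is_derive_div dn dd q0).
  by apply; field; rewrite gt_eqF ?gt_eqF//; lra.
have : f 1 <= f t.
  apply: (@ler0_derive1_nincr _ f t 1) => //.
  - by move=> x /[!in_itv]/=/andP[tx _]; have [] := df x (lt_trans t0 tx).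
  - move=> x /[!in_itv]/=/andP[tx x1]; have x0 := lt_trans t0 tx.
    rewrite derive1E; have [_ ->] := df x x0.
    rewrite pmulr_lle0 ?invr_gt0 ?mulr_gt0 ?exprn_gt0 ?addr_gt0//.
    rewrite exprS pmulr_lle0 ?subr_le0 ?ltW//.
    by rewrite exprn_even_gt0//= subr_eq0 lt_eqF.
  - apply: continuous_in_subspaceT => x /[!inE]/=/[!in_itv]/=/andP[tx _].
    apply: differentiable_continuous; apply/derivable1_diffP.
    by have [] := df x (lt_le_trans t0 tx).
by rewrite /f ln1 subrr !mul0r addr0; lra.
Qed.

End logarithm_bounds.

(** * The radial profile and its differential inequality *)

Section profile.
Variable R : realType.
Implicit Types t : R.

(* The vector field is F z = prof t *: z with t = |z|^(1/2), the variable that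
   makes a rational profile suffice. *)
Definition prof t : R := (3 + 5 * t) / (3 * t * (t ^+ 2 + t + 2)).

Definition dprof t : R :=
  - (2 * (5 * t ^+ 3 + 7 * t ^+ 2 + 3 * t + 3)) /
    (3 * t ^+ 2 * (t ^+ 2 + t + 2) ^+ 2).

Lemma is_derive_prof t : 0 < t -> is_derive t 1 prof (dprof t).
Proof.
move=> t0; have q0 : t ^+ 2 + t + 2 != 0 by rewrite gt_eqF//; nra.
have dn : is_derive t 1 (fun t : R => 3 + 5 * t) 5.
  by apply: is_derive_eq; rewrite /GRing.scale/=; ring.
have dd : is_derive t 1 (fun t : R => 3 * t * (t ^+ 2 + t + 2))
    (9 * t ^+ 2 + 6 * t + 6).
  by apply: is_derive_eq; rewrite /GRing.scale/=; ring.
have d0 : 3 * t * (t ^+ 2 + t + 2) != 0.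
  by rewrite mulf_neq0// mulf_neq0// gt_eqF.
have /is_derive_eq := is_derive_div dn dd d0.
by apply; rewrite /dprof; field; rewrite q0 gt_eqF.
Qed.

(* This is div F - |F|^2 >= 1/2 - ln |z| for the field F z = prof t *: z. *)
Lemma prof_ineq t : 0 < t ->
  1 / 2 - 2 * ln t <= 2 * prof t + t / 2 * dprof t - t ^+ 4 * prof t ^+ 2.
Proof.
move=> t0; have q0 : 0 < t ^+ 2 + t + 2 by nra.
pose D := 9 * t * (t ^+ 2 + t + 2) ^+ 2.
have D0 : 0 < D by rewrite /D !mulr_gt0// exprn_gt0.
rewrite -subr_ge0.
set A := 6 * (3 + 5 * t) * (t ^+ 2 + t + 2)
  - 3 * (5 * t ^+ 3 + 7 * t ^+ 2 + 3 * t + 3) - t ^+ 3 * (3 + 5 * t) ^+ 2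
  - 9 / 2 * t * (t ^+ 2 + t + 2) ^+ 2.
have -> : 2 * prof t + t / 2 * dprof t - t ^+ 4 * prof t ^+ 2
    - (1 / 2 - 2 * ln t) = A / D + 2 * ln t.
  by rewrite /A /D /prof /dprof; field; rewrite !gt_eqF.
have [t1|/ltW t1] := leP 1 t.
  apply: (@le_trans _ _
      (A / D + 2 * (3 * (t ^+ 2 - 1) / (t ^+ 2 + 4 * t + 1)))); last first.
    by rewrite lerD2l ler_pM2l//; exact: ln_ge_pade.
  have r0 : 0 < t ^+ 2 + 4 * t + 1 by nra.
  (* The numerator has nonnegative Taylor coefficients at t = 1. *)
  pose s := t - 1; have s0 : 0 <= s by rewrite subr_ge0.
  have -> : A / D + 2 * (3 * (t ^+ 2 - 1) / (t ^+ 2 + 4 * t + 1)) =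
      (24 * s ^+ 0 + 72 * s ^+ 1 + 130 * s ^+ 2 + 164 * s ^+ 3 + 409 * s ^+ 4
       + 469 * s ^+ 5 + 245 * s ^+ 6 + 49 * s ^+ 7) /
      (2 * (D * (t ^+ 2 + 4 * t + 1))).
    by rewrite /A /D /s; field; rewrite !gt_eqF.
  apply: divr_ge0; last by rewrite mulr_ge0 ?ler0n// mulr_ge0 ?ltW.
  have pos (c n : nat) : 0 <= c%:R * s ^+ n :> R := mulr_ge0 (ler0n R c) (exprn_ge0 n s0).
  by do 7! [apply: addr_ge0; last exact: pos]; exact: pos.
apply: (@le_trans _ _
    (A / D + 2 * - ((1 - t) * (1 + 5 * t) / (2 * t * (2 + t))))); last first.
  by rewrite lerD2l ler_pM2l//; apply: ln_ge_pade_inv; rewrite t0.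
have r0 : 0 < 2 + t by rewrite addr_gt0.
(* The numerator has nonnegative Bernstein coefficients on [0, 1]. *)
pose s := 1 - t; have s0 : 0 <= s by rewrite subr_ge0.
have -> : A / D + 2 * - ((1 - t) * (1 + 5 * t) / (2 * t * (2 + t))) =
    (36 * (t ^+ 0 * s ^+ 6) + 114 * (t ^+ 1 * s ^+ 5) + 150 * (t ^+ 2 * s ^+ 4)
     + 96 * (t ^+ 3 * s ^+ 3) + 87 * (t ^+ 4 * s ^+ 2) + 44 * (t ^+ 5 * s ^+ 1)
     + 12 * (t ^+ 6 * s ^+ 0)) / (2 * (D * (2 + t))).
  by rewrite /A /D /s; field; rewrite !gt_eqF.
have t0' := ltW t0.
apply: divr_ge0; last by rewrite mulr_ge0 ?ler0n// mulr_ge0 ?ltW.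
have pos (c m n : nat) : 0 <= c%:R * (t ^+ m * s ^+ n) :> R :=
  mulr_ge0 (ler0n R c) (mulr_ge0 (exprn_ge0 m t0') (exprn_ge0 n s0)).
by do 6! [apply: addr_ge0; last exact: pos]; exact: pos.
Qed.

End profile.

(** * Components of the radial field *)

Section vector_field_component.
Variable R : realType.
Implicit Types (t s c : R).

Definition rad s c : R := Num.sqrt (Num.sqrt (s ^+ 2 + c ^+ 2)).

(* vcomp s c is the component of F in the direction of the coordinate s. *)
Definition vcomp s c : R := s * prof (rad s c).

Definition dvcomp s c : R :=
  prof (rad s c) + s ^+ 2 / (2 * rad s c ^+ 3) * dprof (rad s c).

Lemma rad2 s c : rad s c ^+ 2 = Num.sqrt (s ^+ 2 + c ^+ 2).
Proof. by rewrite sqr_sqrtr ?sqrtr_ge0. Qed.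

Lemma rad4 s c : rad s c ^+ 4 = s ^+ 2 + c ^+ 2.
Proof. by rewrite (exprM _ 2 2) rad2 sqr_sqrtr// addr_ge0 ?sqr_ge0. Qed.

Lemma rad_ge0 s c : 0 <= rad s c. Proof. exact: sqrtr_ge0. Qed.

Lemma radC s c : rad s c = rad c s. Proof. by rewrite /rad addrC. Qed.

Lemma rad_gt0 s c : (s, c) != 0 -> 0 < rad s c.
Proof.
move=> sc; rewrite !sqrtr_gt0 lt0r paddr_eq0 ?sqr_ge0// !sqrf_eq0.
by rewrite addr_ge0 ?sqr_ge0// andbT.
Qed.

Lemma is_derive_vcomp s c : (s, c) != 0 ->
  is_derive s 1 (vcomp ^~ c) (dvcomp s c).
Proof.
move=> /rad_gt0 t0.
have r0 : 0 < s ^+ 2 + c ^+ 2 by move: t0; rewrite !sqrtr_gt0.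
have d1 : is_derive s 1 (fun s : R => s ^+ 2 + c ^+ 2) (2 * s).
  by apply: is_derive_eq; rewrite /GRing.scale/=; ring.
have d2 := @is_derive1_comp _ Num.sqrt (fun s : R => s ^+ 2 + c ^+ 2) _ _ _
  (is_derive1_sqrt r0) d1.
have t2 : 0 < Num.sqrt (s ^+ 2 + c ^+ 2) by rewrite sqrtr_gt0.
have d3 := @is_derive1_comp _ Num.sqrt
  (Num.sqrt \o (fun s : R => s ^+ 2 + c ^+ 2)) _ _ _ (is_derive1_sqrt t2) d2.
have d4 := @is_derive1_comp _ (@prof R) (rad ^~ c) _ _ _ (is_derive_prof t0) d3.
have /is_derive_eq := is_deriveM (is_derive_id s (1 : R)) d4.
apply; rewrite /dvcomp /GRing.scale/= -rad2 sqrtr_sqr (gtr0_norm t0).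
by field; rewrite gt_eqF.
Qed.

(** With t = [rad s c], the identity s^2 + c^2 = t^4 turns the right side into that of [prof_ineq],
    and the logarithm of the Euclidean norm into 2 ln t. *)
Lemma vcomp_ineq s c : (s, c) != 0 ->
  1 / 2 - ln (Num.sqrt (s ^+ 2 + c ^+ 2)) <=
  dvcomp s c + dvcomp c s - vcomp s c ^+ 2 - vcomp c s ^+ 2.
Proof.
move=> /rad_gt0 t0; rewrite -rad2 lnXn// -[ln _ *+ 2]mulr_natl.
apply: (le_trans (prof_ineq t0)).
rewrite le_eqVlt; apply/orP; left; apply/eqP.
rewrite /dvcomp /vcomp (radC c s).
move: (prof _) (dprof _) => p dp; rewrite !exprMn rad4.
have -> : s ^+ 2 = rad s c ^+ 4 - c ^+ 2 by rewrite rad4 addrK.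
by field; rewrite gt_eqF.
Qed.

Lemma normr_le_rad2 s c : `|s| <= rad s c ^+ 2.
Proof. by rewrite rad2 -sqrtr_sqr ler_wsqrtr// lerDl sqr_ge0. Qed.

Lemma prof_ge0 t : 0 <= t -> 0 <= prof t.
Proof.
move=> t0; rewrite divr_ge0 ?addr_ge0 ?mulr_ge0//.
by rewrite !addr_ge0 ?mulr_ge0 ?sqr_ge0.
Qed.

(** The length of the field is t^2 prof t, which stays below its limit 5 / 3 at infinity. *)
Lemma vcomp_bounded s c : `|vcomp s c| <= 5 / 3.
Proof.
have [/eqP|/rad_gt0 t0] := eqVneq (s, c) 0.
  by move=> /eqP[-> _]; rewrite /vcomp mul0r normr0; lra.
rewrite normrM (ger0_norm (prof_ge0 (rad_ge0 s c))).
apply: (le_trans (ler_wpM2r (prof_ge0 (rad_ge0 s c)) (normr_le_rad2 s c))).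
move: (rad s c) t0 => t t0; rewrite /prof.
have q0 : 0 < t ^+ 2 + t + 2 by nra.
have -> : t ^+ 2 * ((3 + 5 * t) / (3 * t * (t ^+ 2 + t + 2))) =
   (t * (3 + 5 * t)) / (3 * (t ^+ 2 + t + 2)) by field; rewrite !gt_eqF.
by rewrite ler_pdivrMr ?mulr_gt0//; nra.
Qed.

Lemma vcompN s c : vcomp (- s) c = - vcomp s c.
Proof. by rewrite /vcomp /rad sqrrN mulNr. Qed.

(** The component is s / t^2, the cosine of the angle with the axis, times t^2 prof t, the length of
    the field. Both factors are nonnegative and nondecreasing in s >= 0. *)
Let vcomp_nondecreasing_pos s1 s2 c : 0 <= s1 -> s1 <= s2 -> vcomp s1 c <= vcomp s2 c.
Proof.
move=> s10 s12; have s20 := le_trans s10 s12.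
have [/eqP|/rad_gt0 t0] := eqVneq (s1, c) 0.
  by move=> /eqP[-> _]; rewrite /vcomp mul0r mulr_ge0// prof_ge0// rad_ge0.
have s122 : s1 ^+ 2 <= s2 ^+ 2 by rewrite ler_sqr ?nnegrE.
have t12 : rad s1 c <= rad s2 c by rewrite !ler_wsqrtr// lerD2r.
have : s1 * rad s2 c ^+ 2 <= s2 * rad s1 c ^+ 2.
  rewrite -ler_sqr; [|by rewrite nnegrE mulr_ge0 ?sqr_ge0..].
  rewrite (exprMn 2 s1) (exprMn 2 s2) -!exprM !rad4.
  by have := sqr_ge0 c; nra.
rewrite /vcomp /prof; move: (rad s1 c) (rad s2 c) t0 t12 => t t' t0 tt' h.
have t'0 := lt_le_trans t0 tt'.
have q0 : 0 < t ^+ 2 + t + 2 by nra.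
have q'0 : 0 < t' ^+ 2 + t' + 2 by nra.
have -> : s1 * ((3 + 5 * t) / (3 * t * (t ^+ 2 + t + 2))) =
   (s1 / t ^+ 2) * ((t * (3 + 5 * t)) / (3 * (t ^+ 2 + t + 2))).
  by field; rewrite !gt_eqF.
have -> : s2 * ((3 + 5 * t') / (3 * t' * (t' ^+ 2 + t' + 2))) =
   (s2 / t' ^+ 2) * ((t' * (3 + 5 * t')) / (3 * (t' ^+ 2 + t' + 2))).
  by field; rewrite !gt_eqF.
apply: ler_pM.
- by rewrite divr_ge0// sqr_ge0.
- by rewrite divr_ge0// mulr_ge0// ?addr_ge0 ?mulr_ge0 ?ltW.
- rewrite ler_pdivrMr ?exprn_gt0// mulrAC ler_pdivlMr ?exprn_gt0//.
- rewrite ler_pdivrMr ?mulr_gt0// mulrAC ler_pdivlMr ?mulr_gt0// -subr_ge0.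
  rewrite [leRHS](_ : _ = 3 * ((t' - t) * (6 + 10 * (t + t') + 2 * (t * t')))).
    by rewrite !mulr_ge0 ?subr_ge0// !addr_ge0 ?mulr_ge0 ?addr_ge0 ?ltW.
  by ring.
Qed.

Lemma vcomp_nondecreasing s1 s2 c : s1 <= s2 -> vcomp s1 c <= vcomp s2 c.
Proof.
move=> s12; have [s10|/ltW s10] := leP 0 s1.
  exact: vcomp_nondecreasing_pos.
have [s20|/ltW s20] := leP 0 s2.
  apply: (@le_trans _ _ 0).
    by rewrite /vcomp mulr_le0_ge0// prof_ge0// rad_ge0.
  by rewrite mulr_ge0// prof_ge0// rad_ge0.
rewrite -(opprK s1) -(opprK s2) vcompN [leRHS]vcompN lerN2.
by rewrite vcomp_nondecreasing_pos ?oppr_ge0// lerN2.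
Qed.

End vector_field_component.

(** * The dilated field on the plane *)

Section vector_field.
Variable R : realType.
Local Notation T1 := (measurableTypeR R).
Local Notation T2 := (T1 * T1)%type.
Implicit Types (i : 'I_2) (l : R) (z : R * R).

Lemma measurable_sqrt : measurable_fun setT (@Num.sqrt R : T1 -> T1).
Proof. by apply: continuous_measurable_fun; exact: sqrt_continuous. Qed.

Lemma measurable_enorm : measurable_fun setT (@enorm R : T2 -> R).
Proof.
apply: (measurableT_comp measurable_sqrt); apply: measurable_funD.
  by apply: measurable_funX; exact: measurable_fst.
by apply: measurable_funX; exact: measurable_snd.
Qed.

Lemma measurable_vcomp : measurable_fun setT (fun z : T2 => vcomp z.1 z.2).
Proof.
have mrad : measurable_fun setT (fun z : T2 => rad z.1 z.2).
  exact: (measurableT_comp measurable_sqrt measurable_enorm).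
(* The denominator vanishes at the origin, where continuity fails; the power -1 is measurable on the
   whole line and agrees with the inverse on nonnegative numbers, 0 included. *)
have -> : (fun z : T2 => vcomp z.1 z.2) = (fun z => z.1 * ((3 + 5 * rad z.1 z.2) *
    (3 * rad z.1 z.2 * (rad z.1 z.2 ^+ 2 + rad z.1 z.2 + 2)) `^ (-1))).
  apply/funext => z; rewrite powR_inv1//.
  by rewrite mulr_ge0 ?mulr_ge0 ?addr_ge0 ?sqr_ge0 ?rad_ge0.
apply: measurable_funM; first exact: measurable_fst.
apply: measurable_funM; first by apply: measurable_funD => //; exact: measurable_funM.
apply: (measurableT_comp (measurable_powR (-1))).
apply: measurable_funM; first exact: measurable_funM.
by apply: measurable_funD => //; apply: measurable_funD => //; exact: measurable_funX.
Qed.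

(** The field l F(l z): its divergence and its squared length both gain the factor l^2. Dilating the
    field spares a rescaling of u. *)
Definition vfield l i z : R :=
  if val i == 0%N then l * vcomp (l * z.1) (l * z.2) else l * vcomp (l * z.2) (l * z.1).

Definition dvfield l i z : R :=
  if val i == 0%N then l ^+ 2 * dvcomp (l * z.1) (l * z.2)
  else l ^+ 2 * dvcomp (l * z.2) (l * z.1).

Lemma measurable_field l i : measurable_fun setT (vfield l i : T2 -> R).
Proof.
rewrite /vfield; case: (val i == 0%N); apply: measurable_funM => //.
  have m : measurable_fun setT (fun z : T2 => (l * z.1, l * z.2) : T2).
    by apply/measurable_fun_pair; apply: measurable_funM.
  exact: (measurableT_comp measurable_vcomp m).
have m : measurable_fun setT (fun z : T2 => (l * z.2, l * z.1) : T2).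
  by apply/measurable_fun_pair; apply: measurable_funM.
exact: (measurableT_comp measurable_vcomp m).
Qed.

Lemma field_bounded l i z : 0 <= l -> `|vfield l i z| <= l * (5 / 3).
Proof.
by move=> l0; rewrite /vfield; case: ifPn => _;
  rewrite normrM (ger0_norm l0) ler_wpM2l// vcomp_bounded.
Qed.

Lemma field_nondecreasing l i z (h : R) : 0 <= l -> 0 <= h ->
  vfield l i z <= vfield l i (z + h *: axis R i).
Proof.
move=> l0 h0; rewrite /vfield /axis; case: ifPn => _ /=.
  rewrite scaler0 addr0 /GRing.scale/= mulr1 ler_wpM2l// vcomp_nondecreasing//.
  by rewrite ler_wpM2l// lerDl.
rewrite scaler0 addr0 /GRing.scale/= mulr1 ler_wpM2l// vcomp_nondecreasing//.
by rewrite ler_wpM2l// lerDl.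
Qed.

Lemma cvg_harmonic_dnbhs : (n.+1%:R^-1 : R) @[n --> \oo] --> (0 : R)^'.
Proof.
move=> A; rewrite /dnbhs /within /= => A0.
have H : \forall n \near \oo, harmonic n != 0 :> R -> A (harmonic n).
  exact: (@cvg_harmonic R _ A0).
suff : \forall n \near \oo, A (n.+1%:R^-1 : R) by [].
by apply: filterS H => n; apply; rewrite /harmonic/= invr_eq0 pnatr_eq0.
Qed.

Lemma cvg_quotient (f : R -> R) (x d : R) : is_derive x 1 f d ->
  (f (x + n.+1%:R^-1) - f x) / n.+1%:R^-1 @[n --> \oo] --> d.
Proof.
move=> [df <-]; have := cvg_comp _ _ cvg_harmonic_dnbhs df.
apply: cvg_trans; apply: near_eq_cvg; apply: nearW => n.
by rewrite /= /GRing.scale/= mulr1 [_ + x]addrC mulrC.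
Qed.

Lemma is_derive_scaled_vcomp l (s c : R) : 0 < l -> (s, c) != 0 ->
  is_derive s 1 (fun s : R => l * vcomp (l * s) (l * c)) (l ^+ 2 * dvcomp (l * s) (l * c)).
Proof.
move=> l0 sc; have lsc : (l * s, l * c) != 0.
  apply: contra_neq sc => -[/eqP + /eqP]; rewrite !mulf_eq0 gt_eqF//=.
  by move=> /eqP-> /eqP->.
have dl : is_derive s 1 (fun s : R => l * s) l.
  by apply: is_derive_eq; rewrite /GRing.scale/=; ring.
have d1 := @is_derive1_comp _ (fun s : R => vcomp s (l * c)) (fun s : R => l * s) _ _ _
  (is_derive_vcomp lsc) dl.
have /is_derive_eq := is_deriveZ l d1; apply.
by rewrite /GRing.scale/=; ring.
Qed.

(** The origin is excluded because F behaves there like z / (2 |z|^(1/2)) and has infinite slope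
    along the axes. *)
Lemma cvg_field_quotient l i z : 0 < l -> z != 0 ->
  (vfield l i (z + n.+1%:R^-1 *: axis R i) - vfield l i z) / n.+1%:R^-1
    @[n --> \oo] --> dvfield l i z.
Proof.
move=> l0; case: z => x y z0; rewrite /vfield /dvfield /axis; case: ifPn => _ /=.
  have := cvg_quotient (is_derive_scaled_vcomp l0 z0).
  apply: cvg_trans; apply: near_eq_cvg; apply: nearW => n.
  by rewrite /= scaler0 addr0 /GRing.scale/= mulr1.
have z0' : (y, x) != 0 by apply: contra_neq z0 => -[-> ->].
have := cvg_quotient (is_derive_scaled_vcomp l0 z0').
apply: cvg_trans; apply: near_eq_cvg; apply: nearW => n.
by rewrite /= scaler0 addr0 /GRing.scale/= mulr1.
Qed.

Lemma field_ineq l z : 0 < l -> z != 0 ->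
  l ^+ 2 * (1 / 2 - ln l - ln (enorm z)) <=
  \sum_(i < 2) (dvfield l i z - vfield l i z ^+ 2).
Proof.
case: z => x y l0 z0; rewrite big_ord_recl big_ord1 /vfield /dvfield /=.
have lz : (l * x, l * y) != 0.
  apply: contra_neq z0 => -[/eqP + /eqP]; rewrite !mulf_eq0 gt_eqF//=.
  by move=> /eqP-> /eqP->.
have := vcomp_ineq lz.
have -> : Num.sqrt ((l * x) ^+ 2 + (l * y) ^+ 2) = l * enorm (x, y).
  by rewrite !exprMn -mulrDr sqrtrM ?sqr_ge0// sqrtr_sqr gtr0_norm.
have e0 : 0 < enorm (x, y).
  rewrite sqrtr_gt0/= lt0r paddr_eq0 ?sqr_ge0// !sqrf_eq0 addr_ge0 ?sqr_ge0// andbT.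
  exact: z0.
rewrite lnM ?posrE// opprD addrA => h.
rewrite !(exprMn 2 l) addrACA -opprD -!mulrDr -mulrBr ler_pM2l ?exprn_gt0//.
by rewrite opprD addrA.
Qed.

End vector_field.

(** * Measure-preserving maps and translations *)

Section measure_preserving.
Local Open Scope ereal_scope.
Context d (T : measurableType d) (R : realType).
Variables (mu : {measure set T -> \bar R}) (phi : T -> T).
Hypothesis mphi : measurable_fun setT phi.
Hypothesis mu_phi : forall A, measurable A -> mu (phi @^-1` A) = mu A.

Lemma ge0_integral_preserving (f : T -> \bar R) :
  measurable_fun setT f -> (forall x, 0 <= f x) ->
  \int[mu]_x f (phi x) = \int[mu]_x f x.
Proof.
move=> mf f0; rewrite -[LHS]/(\int[mu]_(x in phi @^-1` setT) (f \o phi) x).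
rewrite -(ge0_integral_pushforward mphi mu measurableT mf); last by [].
by apply: eq_measure_integral => A mA _; exact: mu_phi.
Qed.

Lemma integral_preserving (f : T -> \bar R) : measurable_fun [set: T] f ->
  \int[mu]_x f (phi x) = \int[mu]_x f x.
Proof.
move=> mf; rewrite -[LHS]/(\int[mu]_x (f \o phi) x) [LHS]integralE [RHS]integralE.
under [X in X - _]eq_integral do rewrite funepos_comp/=.
under [X in _ - X]eq_integral do rewrite funeneg_comp/=.
rewrite !ge0_integral_preserving//.
- exact: measurable_funeneg.
- exact: measurable_funepos.
Qed.

Lemma integrable_preserving (f : T -> \bar R) : mu.-integrable setT f ->
  mu.-integrable setT (f \o phi).
Proof.
move=> /integrableP[mf fi]; apply/integrableP; split.
  exact: measurableT_comp.
rewrite (le_lt_trans _ fi)// (ge0_integral_preserving (f := abse \o f))//.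
  exact: measurableT_comp.
by move=> x /=.
Qed.

End measure_preserving.

Section product_preserving.
Local Open Scope ereal_scope.
Context d (T : measurableType d) (R : realType).
Variables (mu : {sigma_finite_measure set T -> \bar R}) (phi psi : T -> T).
Hypothesis mphi : measurable_fun setT phi.
Hypothesis mpsi : measurable_fun setT psi.
Hypothesis mu_phi : forall A, measurable A -> mu (phi @^-1` A) = mu A.
Hypothesis mu_psi : forall A, measurable A -> mu (psi @^-1` A) = mu A.

Definition map_pair (z : T * T) : T * T := (phi z.1, psi z.2).

Lemma measurable_map_pair : measurable_fun setT map_pair.
Proof.
by apply/measurable_fun_pair; [exact: (measurableT_comp mphi measurable_fst)|
  exact: (measurableT_comp mpsi measurable_snd)].
Qed.

(** It serves twice: to pass from translations of the line to those of the plane, and from these to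
    opposite shifts of two particles. *)
Lemma product_measure_map_pair A : measurable A ->
  (mu \x mu) (map_pair @^-1` A) = (mu \x mu) A.
Proof.
move=> mA; rewrite -[LHS]/(pushforward (mu \x mu) map_pair A).
apply/esym/product_measure_unique => //=; first exact: measurable_map_pair.
move=> ? B C mB mC.
rewrite -[LHS]/((mu \x mu) ((phi @^-1` B) `*` (psi @^-1` C))).
have mB' : measurable (phi @^-1` B).
  by rewrite -[_ @^-1` _]setTI; exact: mphi.
have mC' : measurable (psi @^-1` C).
  by rewrite -[_ @^-1` _]setTI; exact: mpsi.
by rewrite product_measure1E//; congr (_ * _); [exact: mu_phi|exact: mu_psi].
Qed.

End product_preserving.

Section translation.
Variable R : realType.
Local Notation mu1 := (@lebesgue_measure R).
Local Notation mu := (@lebesgue2 R).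
Local Notation T1 := (measurableTypeR R).

Lemma measurable_shift1 (k : R) :
  measurable_fun setT (fun x : T1 => x + k : T1).
Proof. exact: measurable_funD. Qed.

Lemma lebesgue_measure_shift (k : R) (A : set T1) : measurable A ->
  mu1 ((fun x : T1 => x + k : T1) @^-1` A) = mu1 A.
Proof.
move=> mA.
rewrite -[LHS]/(pushforward mu1 (fun x : T1 => x + k : T1) A).
apply/esym/lebesgue_measure_unique => //=; first exact: measurable_shift1.
move=> ? _ [[a b]] _ <-; rewrite /pushforward.
have -> : (fun x : T1 => x + k) @^-1` `]a, b] = `]a - k, b - k]%classic.
  by apply/seteqP; split => x; rewrite /= !in_itv/= ltrBlDr lerBrDr.
rewrite !lebesgue_measure_itv/= !lte_fin ltrD2r.
by case: ifPn => // _; rewrite -!EFinD; congr EFin; ring.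
Qed.

Lemma measurable_shift (v : R * R) :
  measurable_fun setT (fun x : T1 * T1 => x + v : T1 * T1).
Proof.
exact: (measurable_map_pair (@measurable_shift1 v.1) (@measurable_shift1 v.2)).
Qed.

Lemma lebesgue2_shift (v : R * R) (A : set (T1 * T1)) : measurable A ->
  mu ((fun x : T1 * T1 => x + v : T1 * T1) @^-1` A) = mu A.
Proof.
exact: (product_measure_map_pair (@measurable_shift1 v.1) (@measurable_shift1 v.2)
  (@lebesgue_measure_shift v.1) (@lebesgue_measure_shift v.2)).
Qed.

Lemma measurable_subpair :
  measurable_fun setT (fun p : (T1 * T1) * (T1 * T1) => p.1 - p.2 : T1 * T1).
Proof.
apply/measurable_fun_pair.
  apply: (@measurable_funB _ _ _ _ (fun p : (T1 * T1) * (T1 * T1) => p.1.1) (fun p => p.2.1)).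
    exact: (measurableT_comp measurable_fst measurable_fst).
  exact: (measurableT_comp measurable_fst measurable_snd).
apply: (@measurable_funB _ _ _ _ (fun p : (T1 * T1) * (T1 * T1) => p.1.2) (fun p => p.2.2)).
  exact: (measurableT_comp measurable_snd measurable_fst).
exact: (measurableT_comp measurable_snd measurable_snd).
Qed.

End translation.

(** * Smooth functions of one variable with compact support *)

Section smooth.
Variable R : realType.
Implicit Types (f g : R -> R) (x : R) (k m n : nat).

(** The derivative is existentially quantified, so that each closure property supplies it as an
    explicit formula. *)
Fixpoint smooth k f : Prop :=
  if k is k'.+1 then exists2 g, (forall x, is_derive x 1 f (g x)) & smooth k' g
  else continuous f.

Lemma is_derive_continuous f x d : is_derive x 1 f d -> {for x, continuous f}.
Proof.
by case=> fx _; apply: differentiable_continuous; apply/derivable1_diffP.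
Qed.

Lemma smooth_continuous k f : smooth k f -> continuous f.
Proof.
by case: k => //= k [g fg _] x; exact: (is_derive_continuous (fg x)).
Qed.

Lemma smoothS k f : smooth k.+1 f -> smooth k f.
Proof.
elim: k f => [f|k IHk f]; first exact: smooth_continuous.
by move=> [g fg gk]; exists g => //; exact: IHk.
Qed.

Lemma smoothD k f g : smooth k f -> smooth k g -> smooth k (fun x => f x + g x).
Proof.
elim: k f g => [f g cf cg x|k IHk f g [f' ff' kf'] [g' gg' kg']].
  by apply: cvgD; [exact: cf|exact: cg].
by exists (fun x => f' x + g' x); [move=> x; exact: is_deriveD|exact: IHk].
Qed.

Lemma smoothZ k (c : R) f : smooth k f -> smooth k (fun x => c * f x).
Proof.
elim: k f => [f cf x|k IHk f [f' ff' kf']]; first by apply: cvgMr; exact: cf.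
by exists (fun x => c * f' x); [move=> x; exact: is_deriveZ|exact: IHk].
Qed.

Lemma smoothB k f g : smooth k f -> smooth k g -> smooth k (fun x => f x - g x).
Proof.
move=> kf kg; rewrite (_ : (fun x => f x - g x) = (fun x => f x + -1 * g x)).
  by apply: smoothD => //; exact: smoothZ.
by apply/funext => x; rewrite mulN1r.
Qed.

Lemma smoothM k f g : smooth k f -> smooth k g -> smooth k (fun x => f x * g x).
Proof.
elim: k f g => [f g cf cg x|k IHk f g kf kg].
  by apply: cvgM; [exact: cf|exact: cg].
have [[f' ff' kf'] [g' gg' kg']] := (kf, kg).
exists (fun x => f x * g' x + g x * f' x); first by move=> x; exact: is_deriveM.
by apply: smoothD; apply: IHk => //; exact: smoothS.
Qed.

Lemma smooth_affine k (a b : R) f : smooth k f -> smooth k (fun x => f (a * x + b)).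
Proof.
elim: k f => [f cf x|k IHk f [f' ff' kf']].
  apply: continuous_comp; last exact: cf.
  by apply: cvgD; [apply: cvgMr; exact: cvg_id|exact: cvg_cst].
exists (fun x => a * f' (a * x + b)); last exact/smoothZ/IHk.
move=> x; rewrite mulrC.
apply: (@is_derive1_comp _ f (fun x => a * x + b)).
by apply: is_derive_eq; rewrite /GRing.scale/=; ring.
Qed.

(* The factor x^-m closes the family under differentiation. *)
Definition flat m x : R := if 0 < x then x^-1 ^+ m * expR (- x^-1) else 0.

Lemma flat_ge0 m x : 0 <= flat m x.
Proof.
by rewrite /flat; case: ifPn => // x0; rewrite mulr_ge0 ?expR_ge0// exprn_ge0 ?invr_ge0 ?ltW.
Qed.

(** With y = 1 / x this is y^(m+2) / (m+2)! <= exp y. The quadratic bound makes the difference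
    quotients of [flat m] at 0 tend to 0. *)
Lemma flat_le m x : flat m x <= (m.+2)`!%:R * x ^+ 2.
Proof.
rewrite /flat; case: ifPn => [x0|_]; last by rewrite mulr_ge0 ?sqr_ge0.
have y0 : 0 < x^-1 by rewrite invr_gt0.
rewrite -[x ^+ 2]invrK -exprVn; move: (x^-1) y0 => y y0.
rewrite expRN ler_pdivrMr ?expR_gt0// mulrAC ler_pdivlMr ?exprn_gt0//.
rewrite -exprD addn2 mulrC -ler_pdivrMr ?ltr0n ?fact_gt0//.
by apply: (le_trans _ (expR_ge1Dxn m.+1 (ltW y0))); rewrite lerDr.
Qed.

Lemma is_derive_flat m x :
  is_derive x 1 (flat m) (- m%:R * flat m.+1 x + flat m.+2 x).
Proof.
have [x0|x0|->] := ltgtP x 0.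
- rewrite {2 3}/flat !ltNge (ltW x0)/= mulr0 add0r.
  apply: (@near_eq_is_derive _ _ _ (fun=> 0 : R)).
  by near=> y; rewrite /flat ltNge ltW//; near: y; exact: lt_nbhsl.
- rewrite {2 3}/flat x0.
  apply: (@near_eq_is_derive _ _ _ (fun y : R => y^-1 ^+ m * expR (- y^-1))).
    by near=> y; rewrite /flat ifT//; near: y; exact: lt_nbhsr.
  have xn0 : x != 0 by rewrite gt_eqF.
  have dV : is_derive x 1 (fun y : R => y^-1) (- x ^- 2).
    have /is_derive_eq := is_deriveV xn0 (is_derive_id x (1 : R)).
    by apply; rewrite /GRing.scale/= mulr1.
  have dN := is_deriveN dV.
  have dE := @is_derive1_comp _ (@expR R) _ _ _ _ (is_derive_expR _) dN.
  have dX := is_deriveX m dV; rewrite exprfctE in dX.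
  have /is_derive_eq := is_deriveM dX dE.
  apply; rewrite /GRing.scale/= opprK -exprVn.
  case: m {dX} => [|m]; first by rewrite !expr0 !mul0r /=; ring.
  by rewrite !exprS /=; ring.
- have f0 n : flat n 0 = 0 by rewrite /flat ltxx.
  rewrite !f0 mulr0 addr0.
  have cv : h^-1 *: ((flat m \o shift 0) (h *: 1) - flat m 0) @[h --> (0 : R)^'] --> (0 : R).
    pose C : R := (m.+2)`!%:R.
    have hC : C * `|h| @[h --> (0 : R)^'] --> (0 : R).
      apply: cvg_within_filter.
      have : C * `|h| @[h --> (0 : R)] --> C * `|0 : R|.
        by apply: cvgMr; apply: cvg_norm; exact: cvg_id.
      by rewrite normr0 mulr0.
    have hN : - (C * `|h|) @[h --> (0 : R)^'] --> (0 : R).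
      by have := cvgN hC; rewrite oppr0; apply; exact: _.
    apply: (@squeeze_cvgr _ _ _ _ _ _ _ _ _ hN hC).
    near=> h; rewrite -ler_norml /= f0 subr0 addr0 /GRing.scale/= mulr1.
    rewrite normrM normfV (ger0_norm (flat_ge0 _ _)).
    have hn0 : h != 0 by near: h; exact: nbhs_dnbhs_neq.
    rewrite ler_pdivrMl ?normr_gt0// mulrCA -expr2 real_normK ?num_real//.
    exact: flat_le.
  by split; [apply/cvg_ex; exists 0|exact/cvg_lim].
Unshelve. all: by end_near. Qed.

Lemma smooth_flat k m : smooth k (flat m).
Proof.
elim: k m => [m x|k IHk m].
  exact: (is_derive_continuous (is_derive_flat m x)).
exists (fun x => - m%:R * flat m.+1 x + flat m.+2 x); first exact: is_derive_flat.
by apply: smoothD => //; exact: smoothZ.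
Qed.

End smooth.

Lemma integrable_indic_lty d (T : measurableType d) (R : realType)
    (mu : {measure set T -> \bar R}) (A : set T) :
  measurable A -> (mu A < +oo)%E -> mu.-integrable setT (fun x => (\1_A x)%:E).
Proof.
move=> mA muA; apply/integrableP; split; first exact/measurable_EFinP.
under eq_integral do rewrite gee0_abs ?lee_fin//.
by rewrite integral_indic// setIT.
Qed.

Section bump.
Variable R : realType.
Implicit Types (a f : R -> R) (x : R) (k n : nat).
Local Notation mu1 := (@lebesgue_measure R).

Definition bump_function a : Prop :=
  (forall n, smooth n a) /\ exists l r, forall x, a x != 0 -> l <= x <= r.

Lemma bump_continuous a : bump_function a -> continuous a.
Proof. by case=> /(_ 0%N). Qed.

Lemma bump_measurable a : bump_function a -> measurable_fun setT a.
Proof. by move=> /bump_continuous; exact: continuous_measurable_fun. Qed.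

Lemma bump_bounded a : bump_function a -> exists M : R, forall x, `|a x| <= M.
Proof.
move=> Ba; have [_ [l [r lr]]] := Ba.
have [lr0|rl0] := leP l r; last first.
  exists 0 => x; rewrite normr_le0; apply/negPn/negP => /lr /andP[lx xr].
  by have := lt_le_trans rl0 (le_trans lx xr); rewrite ltxx.
have cna : {within `[l, r], continuous (fun x => `|a x|)}.
  apply: continuous_subspaceT => x; apply: cvg_norm; exact: (bump_continuous Ba).
have [c _ cM] := EVT_max lr0 cna.
exists `|a c| => x; have [->|/lr xlr] := eqVneq (a x) 0; first by rewrite normr0.
by apply: cM; rewrite in_itv.
Qed.

Lemma bump_integrable a (D : set (measurableTypeR R)) : measurable D -> bump_function a ->
  mu1.-integrable D (EFin \o a).
Proof.
move=> mD Ba; apply: (@integrableS _ _ _ _ setT) => //.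
have [M aM] := bump_bounded Ba; have [_ [l [r lr]]] := Ba.
pose g (x : measurableTypeR R) := (M * \1_`[l, r] x)%:E.
apply: (@le_integrable _ _ R mu1 setT measurableT (EFin \o a) g).
- by apply/measurable_EFinP; exact: bump_measurable.
- move=> x _ /=; rewrite lee_fin normrM; have := aM x.
  have [->|/lr xlr] := eqVneq (a x) 0; first by rewrite normr0 mulr_ge0.
  rewrite indicE mem_set ?in_itv//= normr1 mulr1 => h.
  by rewrite (le_trans h)// ler_norm.
- rewrite /g; under eq_fun do rewrite EFinM.
  apply: integrableZl => //; apply: integrable_indic_lty; first exact: measurable_itv.
  rewrite -[ltLHS]/(lebesgue_measure `[l, r]%classic) lebesgue_measure_itv/=.
  by case: ifPn => // _; rewrite -EFinB ltry.
Qed.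

Lemma smooth_derive k f : smooth k.+1 f ->
  (forall x, is_derive x 1 f ('D_1 f x)) /\ smooth k ('D_1 f).
Proof.
move=> [g fg gk]; have -> : 'D_1 f = g.
  by apply/funext => x; have [_ ->] := fg x.
by split.
Qed.

(* Testing a weak derivative against such an s turns it into a difference, so
   that no approximation of the function itself is needed. *)
Lemma window_exists a (k : R) : 0 < k -> bump_function a ->
  exists s, [/\ bump_function s, forall x, is_derive x 1 s (a x - a (x - k)) &
    forall x, s x = \int[mu1]_(t in `[0, k]) a (x - t)].
Proof.
move=> k0 Ba; have [sa [l [r lr]]] := Ba.
pose A x := \int[mu1]_(t in `]-oo, x]) a t.
have dA x : is_derive x 1 A (a x).
  have [h1 h2] : derivable A x 1 /\ A^`()%classic x = a x.
    apply: (@continuous_FTC1 R a -oo%O x (x + 1)) => //.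
    - by rewrite ltrDl.
    - exact: bump_integrable.
    - by rewrite /Order.lt/=.
    - exact: (bump_continuous Ba).
  by apply: DeriveDef; [exact: h1|rewrite -derive1E].
pose s x := A x - A (x - k).
have ds x : is_derive x 1 s (a x - a (x - k)).
  apply: is_deriveB => //.
  have dk : is_derive x 1 (fun y => y - k) 1.
    by apply: is_derive_eq; rewrite /GRing.scale/=; ring.
  have /is_derive_eq := @is_derive1_comp _ A (fun y => y - k) _ _ _ (dA (x - k)) dk.
  by apply; rewrite mulr1.
have sE x : s x = \int[mu1]_(t in `[0, k]) a (x - t).
  rewrite /Rintegral (@continuous_FTC2 R (fun t => a (x - t)) (fun t => - A (x - t)))//.
  - by rewrite -EFinB/= subr0 opprK /s addrC.
  - apply: continuous_subspaceT => t; apply: continuous_comp.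
      by apply: cvgB; [exact: cvg_cst|exact: cvg_id].
    exact: (bump_continuous Ba).
  - have dAt (t : R) : is_derive t 1 (fun t => - A (x - t)) (a (x - t)).
      have dk : is_derive t 1 (fun t : R => x - t) (-1).
        by apply: is_derive_eq; rewrite /GRing.scale/=; ring.
      have /is_derive_eq := is_deriveN
        (@is_derive1_comp _ A (fun t => x - t) _ _ _ (dA (x - t)) dk).
      by apply; rewrite mulrN1 opprK.
    have cAt (t : R) : {for t, continuous (fun t => - A (x - t))}.
      exact: (is_derive_continuous (dAt t)).
    split.
    + by move=> t _; have [] := dAt t.
    + by apply: cvg_at_right_filter; exact: cAt.
    + by apply: cvg_at_left_filter; exact: cAt.
  - move=> t _.
    have dk : is_derive t 1 (fun t : R => x - t) (-1).
      by apply: is_derive_eq; rewrite /GRing.scale/=; ring.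
    have := is_deriveN
        (@is_derive1_comp _ A (fun t => x - t) _ _ _ (dA (x - t)) dk).
    by rewrite derive1E => -[_ ->]; rewrite mulrN1 opprK.
exists s; split => //; split.
  move=> [|n].
    by move=> x; exact: (is_derive_continuous (ds x)).
  exists (fun x => a x - a (x - k)) => //.
  apply: smoothB => //.
  have -> : (fun x => a (x - k)) = (fun x => a (1 * x + (- k))).
    by apply/funext => x; rewrite mul1r.
  exact: smooth_affine.
exists l, (r + k) => x; apply: contraNT => xlr; rewrite sE.
rewrite (@eq_Rintegral _ _ _ _ _ (fun=> 0)); first by rewrite /Rintegral integral0.
move=> t.
rewrite inE/= in_itv/= => /andP[t0 tk].
apply/eqP; apply: contraNT xlr => /lr /andP[lt tr].
by apply/andP; split; lra.
Qed.

End bump.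

(** * Products of bump functions as test functions on the plane *)

Section tensor.
Variable R : realType.
Implicit Types (a b : R -> R) (x : R) (k : nat) (z : R * R).
Local Notation mu1 := (@lebesgue_measure R).

Definition tensor a b z : R := a z.1 * b z.2.

Lemma continuous_tensor a b : continuous a -> continuous b ->
  continuous (tensor a b).
Proof.
move=> ca cb z; apply: cvgM.
  by apply: continuous_comp; [exact: cvg_fst|exact: ca].
by apply: continuous_comp; [exact: cvg_snd|exact: cb].
Qed.

Lemma is_derive_tensor1 a b z d : is_derive z.1 1 a d ->
  is_derive z ((1, 0) : R * R) (tensor a b) (d * b z.2).
Proof.
move=> [da <-].
have E : (fun h : R => h^-1 *: ((tensor a b \o shift z) (h *: ((1, 0) : R * R)) - tensor a b z)) =
    (fun h : R => (h^-1 *: ((a \o shift z.1) (h *: 1) - a z.1)) * b z.2).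
  by apply/funext => h; rewrite /tensor /= scaler0 add0r -mulrBl /GRing.scale/= mulrA.
have cv : (h^-1 *: ((tensor a b \o shift z) (h *: ((1, 0) : R * R)) - tensor a b z))
    @[h --> (0 : R)^'] --> 'D_1 a z.1 * b z.2.
  by rewrite E; apply: cvgMl; exact: da.
by split; [apply/cvg_ex; eexists; exact: cv|exact/cvg_lim].
Qed.

Lemma is_derive_tensor2 a b z d : is_derive z.2 1 b d ->
  is_derive z ((0, 1) : R * R) (tensor a b) (a z.1 * d).
Proof.
move=> [db <-].
have E : (fun h : R => h^-1 *: ((tensor a b \o shift z) (h *: ((0, 1) : R * R)) - tensor a b z)) =
    (fun h : R => a z.1 * (h^-1 *: ((b \o shift z.2) (h *: 1) - b z.2))).
  by apply/funext => h; rewrite /tensor /= scaler0 add0r -mulrBr /GRing.scale/= mulrCA.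
have cv : (h^-1 *: ((tensor a b \o shift z) (h *: ((0, 1) : R * R)) - tensor a b z))
    @[h --> (0 : R)^'] --> a z.1 * 'D_1 b z.2.
  by rewrite E; apply: cvgMr; exact: db.
by split; [apply/cvg_ex; eexists; exact: cv|exact/cvg_lim].
Qed.

Lemma Ck_tensor k a b : (forall n, smooth n a) -> (forall n, smooth n b) ->
  Ck k (tensor a b).
Proof.
elim: k a b => [|k IHk] a b sa sb.
  by split => //; apply: continuous_tensor; [exact: (sa 0%N)|exact: (sb 0%N)].
split; first by apply: continuous_tensor; [exact: (sa 0%N)|exact: (sb 0%N)].
have da x : is_derive x 1 a ('D_1 a x) by have [] := smooth_derive (sa 1%N).
have db x : is_derive x 1 b ('D_1 b x) by have [] := smooth_derive (sb 1%N).
move=> i; rewrite /axis; case: ifPn => _.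
  split; first by move=> z; have [] := is_derive_tensor1 b (da z.1).
  have -> : 'D_(1, 0) (tensor a b) = tensor ('D_1 a) b.
    by apply/funext => z; have [_ ->] := is_derive_tensor1 b (da z.1).
  by apply: IHk => // n; have [] := smooth_derive (sa n.+1).
split; first by move=> z; have [] := is_derive_tensor2 a (db z.2).
have -> : 'D_(0, 1) (tensor a b) = tensor a ('D_1 b).
  by apply/funext => z; have [_ ->] := is_derive_tensor2 a (db z.2).
by apply: IHk => // n; have [] := smooth_derive (sb n.+1).
Qed.

Lemma tensor_test_function a b : bump_function a -> bump_function b ->
  test_function (tensor a b).
Proof.
move=> [sa [l [r lr]]] [sb [l' [r' lr']]]; split.
  by move=> k; exact: Ck_tensor.
have cK : compact (`[l, r]%classic `*` `[l', r']%classic : set (R * R)).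
  by apply: compact_setX; exact: segment_compact.
apply: (subclosed_compact _ cK); first exact: closed_closure.
rewrite [X in _ `<=` X](closure_id _).1; last first.
  apply: compact_closed => //; exact: norm_hausdorff.
apply: closure_subset => z /=; rewrite mulf_eq0 negb_or => /andP[/lr z1 /lr' z2].
by split; rewrite /= in_itv.
Qed.

Lemma integrable_reflect a x (k : R) : bump_function a ->
  mu1.-integrable `[0, k] (EFin \o (fun t => a (x - t))).
Proof.
move=> Ba; apply: continuous_compact_integrable; first exact: segment_compact.
apply: continuous_subspaceT => t; apply: continuous_comp.
  by apply: cvgB; [exact: cvg_cst|exact: cvg_id].
exact: (bump_continuous Ba).
Qed.

Lemma tensor_window (i : 'I_2) (k : R) a b : 0 < k -> bump_function a -> bump_function b ->
  exists psi, [/\ test_function psi,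
    forall z, 'D_(axis R i) psi z = tensor a b z - tensor a b (z - k *: axis R i) &
    forall z, psi z = \int[mu1]_(t in `[0, k]) tensor a b (z - t *: axis R i)].
Proof.
move=> k0 Ba Bb; rewrite /axis; case: ifPn => _.
  have [s [Bs ds sE]] := window_exists k0 Ba.
  exists (tensor s b); split; first exact: tensor_test_function.
  - move=> z; have [_ ->] := is_derive_tensor1 b (ds z.1).
    by rewrite /tensor /= scaler0 subr0 /GRing.scale/= mulr1 mulrBl.
  - move=> z; rewrite /tensor sE mulrC -RintegralZl//; last first.
    exact: integrable_reflect.
    apply: eq_Rintegral => t _.
    by rewrite /= scaler0 subr0 /GRing.scale/= mulr1 mulrC.
have [s [Bs ds sE]] := window_exists k0 Bb.
exists (tensor a s); split; first exact: tensor_test_function.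
- move=> z; have [_ ->] := is_derive_tensor2 a (ds z.2).
  by rewrite /tensor /= scaler0 subr0 /GRing.scale/= mulr1 mulrBr.
- move=> z; rewrite /tensor sE -RintegralZl//; last first.
    exact: integrable_reflect.
  apply: eq_Rintegral => t _.
  by rewrite /= scaler0 subr0 /GRing.scale/= mulr1.
Qed.

End tensor.

(** * Bump functions converging to indicators, and the fundamental lemma of the calculus of
    variations *)

Section step.
Variable R : realType.
Implicit Types (x : R) (n : nat).

(* The faster rate n^2 at the right end makes step n s t t converge to 1. *)
Definition step n (s t x : R) : R :=
  flat 0 (n.+1%:R * (x - s)) * flat 0 (n.+1%:R ^+ 2 * (t + n.+1%:R^-1 - x)).

Lemma flat0_le1 x : flat 0 x <= 1.
Proof.
rewrite /flat; case: ifPn => // x0.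
by rewrite expr0 mul1r -expR0 ler_expR oppr_le0 invr_ge0 ltW.
Qed.

Lemma flat0_ge x : 0 < x -> 1 - x^-1 <= flat 0 x.
Proof. by move=> x0; rewrite /flat x0 expr0 mul1r; exact: expR_ge1Dx. Qed.

Lemma step_ge0 n s t x : 0 <= step n s t x.
Proof. by rewrite mulr_ge0// flat_ge0. Qed.

Lemma step_le1 n s t x : step n s t x <= 1.
Proof. by rewrite mulr_ile1// ?flat_ge0// flat0_le1. Qed.

Lemma step_neq0 n s t x : step n s t x != 0 -> s < x < t + n.+1%:R^-1.
Proof.
rewrite mulf_eq0 negb_or /flat => /andP[].
case: ifPn => [+ _|_]; last by rewrite eqxx.
rewrite pmulr_rgt0// subr_gt0 => ->.
case: ifPn => [+ _|_]; last by rewrite eqxx.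
by rewrite pmulr_rgt0 ?exprn_gt0// subr_gt0.
Qed.

Lemma step_support n s t x : step n s t x != 0 -> s <= x <= t + 1.
Proof.
move=> /step_neq0/andP[/ltW-> xt]/=; rewrite (le_trans (ltW xt))// lerD2l.
by rewrite invf_le1 ?ler1n.
Qed.

Lemma step_bump n s t : bump_function (step n s t).
Proof.
split; last by exists s, (t + 1); exact: step_support.
move=> k; apply: smoothM.
  have -> : (fun x => flat 0 (n.+1%:R * (x - s))) =
      (fun x => flat 0 (n.+1%:R * x + - (n.+1%:R * s))).
    by apply/funext => x; rewrite mulrBr.
  exact/smooth_affine/smooth_flat.
have -> : (fun x => flat 0 (n.+1%:R ^+ 2 * (t + n.+1%:R^-1 - x))) =
    (fun x => flat 0 (- n.+1%:R ^+ 2 * x + n.+1%:R ^+ 2 * (t + n.+1%:R^-1))).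
  by apply/funext => x; congr flat; ring.
exact/smooth_affine/smooth_flat.
Qed.

Lemma cvg_flat0 (u : R^nat) (c : R) : 0 < c -> (forall n, c * n.+1%:R <= u n) ->
  flat 0 (u n) @[n --> \oo] --> (1 : R).
Proof.
move=> c0 cu.
have u0 n : 0 < u n by rewrite (lt_le_trans _ (cu n))// mulr_gt0.
have h1 : (fun n => 1 - c^-1 * (n.+1%:R^-1 : R)) @ \oo --> (1 : R).
  have : (fun n => 1 - c^-1 * (n.+1%:R^-1 : R)) @ \oo --> 1 - c^-1 * 0.
    by apply: cvgB; [exact: cvg_cst|apply: cvgMr; exact: cvg_harmonic].
  by rewrite mulr0 subr0.
have h2 : (fun _ : nat => 1 : R) @ \oo --> (1 : R) by exact: cvg_cst.
apply: (@squeeze_cvgr _ _ _ _ _ _ _ _ _ h1 h2).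
apply: nearW => n; rewrite flat0_le1 andbT (le_trans _ (flat0_ge (u0 n)))//.
by rewrite lerD2l lerN2 -invfM lef_pV2 ?posrE ?mulr_gt0.
Qed.

Lemma cvg_step s t x : step n s t x @[n --> \oo] --> (\1_`]s, t]%classic x : R).
Proof.
rewrite indicE; have [/set_mem|] := boolP (x \in `]s, t]%classic).
  rewrite /= in_itv/= => /andP[sx xt].
  rewrite -[X in _ --> X]/((1 : R)) -[X in _ --> X](mulr1 (1 : R)); apply: cvgM.
    apply: (@cvg_flat0 _ (x - s)); first by rewrite subr_gt0.
    by move=> n; rewrite mulrC.
  apply: (@cvg_flat0 _ 1) => // n; rewrite mul1r.
  rewrite -[leLHS](_ : n.+1%:R ^+ 2 * n.+1%:R^-1 = _); last first.
    by rewrite expr2 -mulrA divff ?mulr1.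
  by rewrite ler_pM2l ?exprn_gt0// addrAC lerDr subr_ge0.
rewrite notin_setE /= in_itv/= => /negP; rewrite negb_and -leNgt -ltNge.
move=> xst; suff e : \forall n \near \oo, (0 : R) = step n s t x.
  by apply: (cvg_trans (near_eq_cvg e)); exact: cvg_cst.
case/orP: xst => [xs|tx].
  apply: nearW => n; apply/esym/eqP; apply: contraTT xs => /step_neq0/andP[sx _].
  by rewrite -ltNge.
have := @cvg_harmonic R => /cvgrPdist_lt/(_ (x - t)).
rewrite subr_gt0 => /(_ tx); apply: filterS => n /=.
rewrite sub0r normrN ger0_norm ?invr_ge0// => h.
apply/esym/eqP; rewrite -[_ == _]negbK; apply/negP => /step_neq0/andP[_].
by rewrite ltNge => /negP; apply; rewrite addrC -lerBrDr ltW.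
Qed.

End step.

Section vanishing.
Variable R : realType.
Local Notation mu := (@lebesgue2 R).
Local Notation T1 := (measurableTypeR R).

(** The intervals of [ocitv] are bounded. The whole line is added so that the products contain the
    whole plane, where the induction on Dynkin systems starts, and the strips needed for the
    projections. *)
Let oc : set (set T1) := [set A | A = setT \/ ocitv A].

Let rectangles : set (set (T1 * T1)) := [set A `*` B | A in oc & B in oc].

Let ocI : setI_closed oc.
Proof.
move=> A B [->|oA] [->|oB]; rewrite ?setTI ?setIT; [left|right|right|right] => //.
exact: ocitvI.
Qed.

Let measurable1E : @measurable _ T1 = <<s oc >>.
Proof.
apply/seteqP; split.
  apply: smallest_sub; first exact: smallest_sigma_algebra.
  by move=> A oA; apply: sub_sigma_algebra; right.
apply: smallest_sub; first exact: sigma_algebra_measurable.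
move=> A [->|oA]; first exact: measurableT.
exact: sub_sigma_algebra.
Qed.

Lemma measurable_rectangles : @measurable _ (T1 * T1)%type = <<s rectangles >>.
Proof.
rewrite measurable_prod_measurableType; apply/seteqP; split; last first.
  apply: smallest_sub; first exact: smallest_sigma_algebra.
  move=> _ [A oA [B oB <-]]; apply: sub_sigma_algebra.
  by exists A; [rewrite measurable1E; exact: sub_sigma_algebra|
    exists B => //; rewrite measurable1E; exact: sub_sigma_algebra].
apply: smallest_sub; first exact: smallest_sigma_algebra.
move=> _ [A mA [B mB <-]].
pose T2 := g_sigma_algebraType rectangles.
have m1 : measurable_fun [set: T2] (fst : T2 -> T1).
  apply: (measurability oc) => [|_ [C oC <-]]; first exact: measurable1E.
  rewrite setTI; apply: sub_sigma_algebra; exists C => //.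
  by exists setT; [left|apply/seteqP; split => [x []|x] //].
have m2 : measurable_fun [set: T2] (snd : T2 -> T1).
  apply: (measurability oc) => [|_ [C oC <-]]; first exact: measurable1E.
  rewrite setTI; apply: sub_sigma_algebra; exists setT; first by left.
  by exists C => //; apply/seteqP; split => [x []|x].
have -> : A `*` B = ((fst : T2 -> T1) @^-1` A) `&` ((snd : T2 -> T1) @^-1` B) by [].
suff : @measurable _ T2 (((fst : T2 -> T1) @^-1` A) `&` ((snd : T2 -> T1) @^-1` B)) by [].
apply: measurableI; first by rewrite -[X in measurable X]setTI; exact: m1.
by rewrite -[X in measurable X]setTI; exact: m2.
Qed.

(** The sets over which f integrates to 0 form a Dynkin system, and the rectangles are a generating
    family stable under intersection. *)
Lemma integral_rectangles_eq0 (f : T1 * T1 -> R) :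
  mu.-integrable setT (EFin \o f) ->
  (forall A B, oc A -> oc B -> \int[mu]_(z in A `*` B) (f z)%:E = 0)%E ->
  {ae mu, forall z, f z = 0}.
Proof.
move=> fi f0.
have mf : measurable_fun setT (EFin \o f) by case/integrableP : fi.
have H E : measurable E -> (\int[mu]_(z in E) (f z)%:E = 0)%E.
  rewrite measurable_rectangles.
  move: E; apply: (@dynkin_induction _ (T1 * T1)%type rectangles
    (fun E => \int[mu]_(z in E) (f z)%:E = 0)%E).
  - exact: measurable_rectangles.
  - move=> _ _ [A oA [B oB <-]] [A' oA' [B' oB' <-]].
    by exists (A `&` A'); [exact: ocI|exists (B `&` B'); [exact: ocI|rewrite setXI]].
  - by rewrite -setXTT; apply: f0; left.
  - by move=> _ [A oA [B oB <-]]; exact: f0.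
  - move=> S mS fS0.
    have := f0 setT setT (or_introl erefl) (or_introl erefl).
    rewrite setXTT -(setUv S) integral_setU ?setUv//.
    + by rewrite fS0 add0e.
    + exact: measurableC.
    + by apply/disj_setPS => x [].
  - move=> F mF tF F0; rewrite integral_bigcup//.
      by apply: eseries0 => n _ _; exact: F0.
    by apply: (integrableS measurableT _ _ fi) => //; exact: bigcupT_measurable.
have : ae_eq mu setT (EFin \o f) (cst 0%E).
  apply: integral_ae_eq => // E _ mE.
  by rewrite H// integral0.
by apply: filterS => z /(_ I) [].
Qed.

Lemma measurable_tensor (a b : R -> R) : bump_function a -> bump_function b ->
  measurable_fun setT (tensor a b : T1 * T1 -> R).
Proof.
move=> Ba Bb; apply: measurable_funM.
  by apply: measurableT_comp; [exact: bump_measurable|exact: measurable_fst].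
by apply: measurableT_comp; [exact: bump_measurable|exact: measurable_snd].
Qed.

(** Products of [step] functions converge pointwise to the indicator of the half-open rectangle. All
    of them are at most 1 and live in the larger closed rectangle K, so |f| on K dominates. *)
Lemma integral_test_rectangle (f : T1 * T1 -> R) :
  measurable_fun setT f ->
  (forall l r l' r', mu.-integrable (`[l, r] `*` `[l', r'])%classic (EFin \o f)) ->
  (forall a b, bump_function a -> bump_function b ->
    \int[mu]_z (f z * tensor a b z)%:E = 0)%E ->
  forall s t s' t',
  (\int[mu]_(z in (`]s, t] `*` `]s', t'])%classic) (f z)%:E = 0)%E.
Proof.
move=> mf fi f0 s t s' t'.
pose D : set (T1 * T1) := (`]s, t] `*` `]s', t'])%classic.
pose K : set (T1 * T1) := (`[s, t + 1] `*` `[s', t' + 1])%classic.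
have mD : measurable D by apply: measurableX; exact: measurable_itv.
have mK : measurable K by apply: measurableX; exact: measurable_itv.
pose F n z := (f z * tensor (step n s t) (step n s' t') z)%:E.
have [] := @dominated_convergence _ _ R mu setT measurableT F
   (fun z => (f z * \1_D z)%:E) (fun z => (`|f z| * \1_K z)%:E).
- move=> n; apply/measurable_EFinP; apply: measurable_funM => //.
  by apply: measurable_tensor; exact: step_bump.
- by apply/measurable_EFinP; apply: measurable_funM.
- apply: nearW => z _; apply: cvg_EFin; first exact: nearW.
  rewrite /= /F /comp /=; apply: cvgMr.
  have -> : \1_D z = \1_`]s, t]%classic z.1 * \1_`]s', t']%classic z.2 :> R.
    by rewrite /D !indicE in_setX; case: (_ \in _); case: (_ \in _); rewrite ?mulr1 ?mulr0.
  by apply: cvgM; exact: cvg_step.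
- have := fi s (t + 1) s' (t' + 1) => /integrable_abse.
  move=> /(integrable_mkcond _ mK); apply: eq_integrable => // z _ /=.
  by rewrite /patch indicE; case: ifPn => _ /=; rewrite ?mulr1 ?mulr0.
- apply: nearW => z n _; rewrite /F lee_fin normrM ler_wpM2l//.
  rewrite /tensor normrM !ger0_norm ?step_ge0//.
  have [->|/step_support z1] := eqVneq (step n s t z.1) 0; first by rewrite mul0r.
  have [->|/step_support z2] := eqVneq (step n s' t' z.2) 0; first by rewrite mulr0.
  rewrite indicE mem_set; last by split; rewrite /= in_itv.
  by rewrite mulr_ile1 ?step_ge0 ?step_le1.
move=> _ _; rewrite (_ : [sequence _]_n = cst 0%E); last first.
  by apply/funext => n; apply: f0; exact: step_bump.
move=> h; rewrite integral_mkcond -[RHS](cvg_unique _ h (cvg_cst _))//.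
by apply: eq_integral => z _; rewrite patchE indicE; case: ifPn => _ /=;
  rewrite ?mulr1 ?mulr0.
Qed.

End vanishing.

Section fundamental_lemma.
Variable R : realType.
Local Notation mu := (@lebesgue2 R).
Local Notation T1 := (measurableTypeR R).

(** As f is only locally integrable, it is cut off to the boxes (-N, N]^2. A generating rectangle
    meets such a box in a bounded half-open rectangle, where the preceding lemma applies. *)
Lemma ae_eq0_test (f : T1 * T1 -> R) :
  measurable_fun setT f ->
  (forall l r l' r', mu.-integrable (`[l, r] `*` `[l', r'])%classic (EFin \o f)) ->
  (forall a b, bump_function a -> bump_function b ->
    \int[mu]_z (f z * tensor a b z)%:E = 0)%E ->
  {ae mu, forall z, f z = 0}.
Proof.
move=> mf fi f0.
pose I N : set T1 := `]- N%:R, N%:R]%classic.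
pose fN (N : nat) z := f z * \1_(I N `*` I N) z.
have mI N : measurable (I N `*` I N) by apply: measurableX; exact: measurable_itv.
have fN0 N : {ae mu, forall z, fN N z = 0}.
  apply: integral_rectangles_eq0.
    have := fi (- N%:R) N%:R (- N%:R) N%:R.
    move=> /(integrableS _ (mI N)) => h.
    have {h}/(integrable_mkcond _ (mI N)) : mu.-integrable (I N `*` I N) (EFin \o f).
      apply: h; first by apply: measurableX; exact: measurable_itv.
      by move=> z [z1 z2]; split; apply: subset_itv_oc_cc.
    apply: eq_integrable => // z _ /=.
    by rewrite /patch /fN indicE; case: ifPn => _ /=; rewrite ?mulr1 ?mulr0.
  move=> A B oA oB.
  have oc1 C : C = setT \/ ocitv C -> exists s t, C `&` I N = `]s, t]%classic.
    move=> [->|oC]; first by exists (- N%:R), N%:R; rewrite setTI.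
    have [|[s t] _ <-] := @ocitvI R C (I N) oC; last by exists s, t.
    by exists (- N%:R, N%:R).
  have [s [t Est]] := oc1 _ oA; have [s' [t' Est']] := oc1 _ oB.
  rewrite -(integral_test_rectangle mf fi f0 s t s' t') -Est -Est' setXI.
  rewrite integral_mkcond [RHS]integral_mkcond; apply: eq_integral => z _.
  rewrite !patchE /fN (in_setI z (A `*` B)) indicE.
  by case: (z \in A `*` B); case: (z \in I N `*` I N); rewrite /= ?mulr1 ?mulr0.
have : {ae mu, forall z (N : nat), fN N z = 0} by apply: ae_foralln.
apply: filterS => z H.
have [N [zN1 zN2]] : exists N : nat, `|z.1| < N%:R /\ `|z.2| < N%:R.
  exists (maxn (Num.truncn `|z.1|).+1 (Num.truncn `|z.2|).+1); split.
    by rewrite (lt_le_trans (truncnS_gt _))// ler_nat leq_maxl.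
  by rewrite (lt_le_trans (truncnS_gt _))// ler_nat leq_maxr.
have := H N; rewrite /fN indicE mem_set ?mulr1//.
by split; rewrite /I /= in_itv/=; move: zN1 zN2; rewrite !ltr_norml => /andP[? ?] /andP[? ?];
  apply/andP; split => //; exact: ltW.
Qed.

End fundamental_lemma.

(** * Square-integrable functions and averages along segments *)

Section square_integrable.
Context d (T : measurableType d) (R : realType) (mu : {measure set T -> \bar R}).
Implicit Types f g : T -> R.

Lemma integrable_mul_sqr f g : measurable_fun setT f -> measurable_fun setT g ->
  mu.-integrable setT (fun x => (f x ^+ 2)%:E) ->
  mu.-integrable setT (fun x => (g x ^+ 2)%:E) ->
  mu.-integrable setT (fun x => (f x * g x)%:E).
Proof.
move=> mf mg f2 g2.
apply: (@le_integrable _ _ R mu setT measurableT _ (fun x => (f x ^+ 2)%:E + (g x ^+ 2)%:E)%E).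
- by apply/measurable_EFinP; exact: measurable_funM.
- move=> x _; rewrite -EFinD /= lee_fin.
  rewrite (ger0_norm (addr_ge0 (sqr_ge0 _) (sqr_ge0 _))) ler_norml.
  by apply/andP; split; have := sqr_ge0 (f x - g x); have := sqr_ge0 (f x + g x); nra.
- exact: integrableD.
Qed.

Lemma integrableD_sqr f g : measurable_fun setT f -> measurable_fun setT g ->
  mu.-integrable setT (fun x => (f x ^+ 2)%:E) ->
  mu.-integrable setT (fun x => (g x ^+ 2)%:E) ->
  mu.-integrable setT (fun x => ((f x + g x) ^+ 2)%:E).
Proof.
move=> mf mg f2 g2.
apply: (@le_integrable _ _ R mu setT measurableT _
  (fun x => 2%:E * ((f x ^+ 2)%:E + (g x ^+ 2)%:E))%E).
- by apply/measurable_EFinP; apply: measurable_funX; exact: measurable_funD.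
- move=> x _; rewrite -EFinD -EFinM /= lee_fin !ger0_norm ?sqr_ge0 ?mulr_ge0 ?addr_ge0 ?sqr_ge0//.
  by have := sqr_ge0 (f x - g x); nra.
- by apply: integrableZl => //; exact: integrableD.
Qed.

End square_integrable.

Section slide.
Variable R : realType.
Local Notation mu1 := (@lebesgue_measure R).
Local Notation mu := (@lebesgue2 R).
Local Notation T1 := (measurableTypeR R).
Variables (k : R) (v : R * R).
Hypothesis k0 : 0 <= k.

Local Notation ind t := (\1_`[0, k]%classic t : R).

Definition slide (p : (T1 * T1) * T1) : T1 * T1 := p.1 + p.2 *: v.

Lemma measurable_slide : measurable_fun setT slide.
Proof.
apply/measurable_fun_pair.
  apply: (@measurable_funD _ _ _ _ (fun p : (T1 * T1) * T1 => p.1.1) (fun p => p.2 * v.1)).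
    exact: (measurableT_comp measurable_fst measurable_fst).
  by apply: measurable_funM => //; exact: measurable_snd.
apply: (@measurable_funD _ _ _ _ (fun p : (T1 * T1) * T1 => p.1.2) (fun p => p.2 * v.2)).
  exact: (measurableT_comp measurable_snd measurable_fst).
by apply: measurable_funM => //; exact: measurable_snd.
Qed.

Lemma measurable_slide_fun (f : T1 * T1 -> R) : measurable_fun setT f ->
  measurable_fun setT (fun p => f (slide p) * ind p.2).
Proof.
move=> mf; apply: measurable_funM.
  by apply: measurableT_comp => //; exact: measurable_slide.
by apply: (@measurableT_comp _ _ _ _ _ _ (\1_`[0, k]%classic : T1 -> R)) => //.
Qed.

Lemma integral_indicE : (\int[mu1]_t (ind t)%:E = k%:E)%E.
Proof.
rewrite integral_indic//= setIT lebesgue_measure_itv/= lte_fin.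
case: ltP => [_|k0']; first by rewrite sube0.
by congr EFin; apply/eqP; rewrite eq_le k0.
Qed.

(** For each t in [0, k] the inner integral is that of f, by translation invariance; the factor k is
    the length of the segment. *)
Lemma ge0_integral_slide (f : T1 * T1 -> R) : measurable_fun setT f ->
  (forall z, 0 <= f z) ->
  (\int[mu1]_t \int[mu]_z (f (slide (z, t)) * ind t)%:E =
   k%:E * \int[mu]_z (f z)%:E)%E.
Proof.
move=> mf f0.
transitivity (\int[mu1]_t (\int[mu]_z (f z)%:E * (ind t)%:E))%E.
  apply: eq_integral => t _.
  under eq_integral do rewrite EFinM.
  rewrite ge0_integralZr//; last 2 first.
  - by apply/measurable_EFinP; exact: (measurableT_comp mf (measurable_shift (t *: v))).
  - by move=> z _; rewrite lee_fin.
  congr (_ * _)%E.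
  apply: (ge0_integral_preserving (@measurable_shift R (t *: v)) (@lebesgue2_shift R (t *: v))
    (f := EFin \o f)) => //; exact/measurable_EFinP.
rewrite ge0_integralZl//.
- by rewrite integral_indicE muleC.
- exact/measurable_EFinP.
- by apply: integral_ge0 => z _; rewrite lee_fin.
Qed.

Lemma integrable_slide (f : T1 * T1 -> R) : mu.-integrable setT (EFin \o f) ->
  (mu \x mu1)%E.-integrable setT (fun p => (f (slide p) * ind p.2)%:E).
Proof.
move=> /integrableP[/measurable_EFinP mf fi].
apply/integrable21ltyP.
  by apply/measurable_EFinP; exact: measurable_slide_fun.
have -> : (\int[mu1]_t \int[mu]_z `|(f (slide (z, t)) * ind t)%:E| =
   \int[mu1]_t \int[mu]_z (`|f (slide (z, t))| * ind t)%:E)%E.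
  by apply: eq_integral => t _; apply: eq_integral => z _; rewrite /= normrM [X in _ * X]ger0_norm.
rewrite (@ge0_integral_slide (fun z => `|f z|))//; last exact: measurableT_comp.
by rewrite lte_mul_pinfty.
Qed.

(** The Cauchy-Schwarz inequality on [0, k]: the integral of (f - c)^2 is a nonnegative quadratic
    polynomial in c, evaluated at c = B / k. *)
Lemma sqr_Rintegral_le (f : T1 -> R) : measurable_fun setT f ->
  mu1.-integrable setT (fun t => (f t ^+ 2 * ind t)%:E) ->
  mu1.-integrable setT (fun t => (f t * ind t)%:E) /\
  (\int[mu1]_t (f t * ind t)) ^+ 2 <= k * \int[mu1]_t (f t ^+ 2 * ind t).
Proof.
move=> mf f2.
have mind : measurable_fun setT (\1_`[0, k]%classic : T1 -> R) by [].
have ii : mu1.-integrable setT (fun t => (ind t)%:E).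
  apply: integrable_indic_lty; first exact: measurable_itv.
  by have := integral_indicE; rewrite integral_indic//= setIT => ->; rewrite ltry.
have indM t : ind t * ind t = ind t by rewrite indicE; case: (_ \in _); rewrite ?mulr1 ?mulr0.
have ind0 t : 0 <= ind t by [].
have f1 : mu1.-integrable setT (fun t => (f t * ind t)%:E).
  apply: (@le_integrable _ _ R mu1 setT measurableT _
      (fun t => (f t ^+ 2 * ind t)%:E + (ind t)%:E)%E).
  - by apply/measurable_EFinP; exact: measurable_funM.
  - move=> t _; rewrite -EFinD /= lee_fin normrM (ger0_norm (ind0 t)).
    have h : 0 <= f t ^+ 2 * ind t + ind t by rewrite addr_ge0// mulr_ge0// sqr_ge0.
    rewrite (ger0_norm h).
    rewrite -[X in _ <= _ + X]mul1r -mulrDl ler_wpM2r//.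
    by rewrite -[in leRHS](real_normK (num_real (f t))); have := sqr_ge0 (`|f t| - 1); nra.
  - exact: integrableD.
split => //.
set B := \int[mu1]_t _; set Q := \int[mu1]_t _.
have H c : 0 <= Q - 2 * c * B + c ^+ 2 * k.
  have : 0 <= \int[mu1]_t (f t ^+ 2 * ind t - 2 * c * (f t * ind t) + c ^+ 2 * ind t).
    apply: Rintegral_ge0 => t _.
    rewrite [leRHS](_ : _ = (f t - c) ^+ 2 * ind t); last by ring.
    by rewrite mulr_ge0// sqr_ge0.
  have i1 : mu1.-integrable setT (EFin \o (fun t => 2 * c * (f t * ind t))).
    have := integrableZl measurableT (2 * c) f1.
    by apply: eq_integrable => // t _ /=; rewrite EFinM.
  have i2 : mu1.-integrable setT (EFin \o (fun t => c ^+ 2 * ind t)).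
    have := integrableZl measurableT (c ^+ 2) ii.
    by apply: eq_integrable => // t _ /=; rewrite EFinM.
  have i3 : mu1.-integrable setT (EFin \o (fun t => f t ^+ 2 * ind t - 2 * c * (f t * ind t))).
    by have := integrableB measurableT f2 i1; apply: eq_integrable => // t _ /=; rewrite EFinB.
  rewrite RintegralD// RintegralB// !RintegralZl//.
  by rewrite [X in _ + _ * X](_ : _ = k)// /Rintegral integral_indicE.
have [kE|kN0] := eqVneq k 0.
  rewrite kE mul0r; have [->|B0] := eqVneq B 0; first by rewrite expr0n.
  (* For k = 0 the polynomial is affine in c, and this c would give it the value -1 if B were not
     0. *)
  have := H ((Q + 1) / B / 2); rewrite kE mulr0 addr0.
  have -> : Q - 2 * ((Q + 1) / B / 2) * B = - 1 by field.
  by rewrite oppr_ge0 ler10.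
have kp : 0 < k by rewrite lt_neqAle eq_sym kN0.
have := H (B / k).
have -> : Q - 2 * (B / k) * B + (B / k) ^+ 2 * k = (k * Q - B ^+ 2) / k by field.
by rewrite pmulr_lge0 ?invr_gt0// subr_ge0.
Qed.

End slide.

Section tensor_integrable.
Variable R : realType.
Local Notation mu := (@lebesgue2 R).
Local Notation T1 := (measurableTypeR R).
Implicit Types a b : R -> R.

Lemma tensor_bounded a b : bump_function a -> bump_function b ->
  exists M : R, forall z, `|tensor a b z| <= M.
Proof.
move=> /bump_bounded[M aM] /bump_bounded[N bN]; exists (M * N) => z.
by rewrite normrM ler_pM.
Qed.

Lemma lebesgue2_box_lty (l r l' r' : R) : (mu (`[l, r]%classic `*` `[l', r']%classic) < +oo)%E.
Proof.
have itvoo (s t : R) : (lebesgue_measure `[s, t]%classic < +oo :> \bar R)%E.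
  by rewrite lebesgue_measure_itv/=; case: ifPn => // _; rewrite -EFinB ltry.
rewrite /lebesgue2 product_measure1E; try exact: measurable_itv.
by rewrite lte_mul_pinfty// ?itvoo// ge0_fin_numE ?itvoo.
Qed.

Lemma integrable_tensor a b : bump_function a -> bump_function b ->
  mu.-integrable setT (EFin \o tensor a b).
Proof.
move=> Ba Bb; have [M abM] := tensor_bounded Ba Bb.
have [[_ [l [r lr]]] [_ [l' [r' lr']]]] := (Ba, Bb).
pose D : set (T1 * T1) := `[l, r]%classic `*` `[l', r']%classic.
have M0 : 0 <= M by exact: le_trans (abM 0).
apply: (@le_integrable _ _ R mu setT measurableT _ (fun z => M%:E * (\1_D z)%:E)%E).
- by apply/measurable_EFinP; exact: measurable_tensor.
- move=> z _; rewrite -EFinM /= lee_fin (ger0_norm (mulr_ge0 M0 _))//.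
  have [->|] := eqVneq (tensor a b z) 0; first by rewrite normr0 mulr_ge0.
  rewrite mulf_eq0 negb_or => /andP[/lr z1 /lr' z2].
  by rewrite indicE mem_set ?mulr1//; split; rewrite /= in_itv.
- apply: integrableZl => //; apply: integrable_indic_lty.
    by apply: measurableX; exact: measurable_itv.
  exact: lebesgue2_box_lty.
Qed.

Lemma bump_sqr a : bump_function a -> bump_function (fun x => a x * a x).
Proof.
move=> [sa [l [r lr]]]; split; first by move=> n; exact: smoothM.
by exists l, r => x; rewrite mulf_eq0 orbb; exact: lr.
Qed.

Lemma integrable_tensor_sqr a b : bump_function a -> bump_function b ->
  mu.-integrable setT (fun z => (tensor a b z ^+ 2)%:E).
Proof.
move=> /bump_sqr Ba /bump_sqr Bb; have := integrable_tensor Ba Bb.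
by apply: eq_integrable => // z _ /=; congr EFin; rewrite /tensor; ring.
Qed.

End tensor_integrable.

(** * The translation estimate for a function with a weak derivative *)

Section difference.
Variable R : realType.
Local Notation mu1 := (@lebesgue_measure R).
Local Notation mu := (@lebesgue2 R).
Local Notation T1 := (measurableTypeR R).
Variables (i : 'I_2) (k : R) (a g : R * R -> R).
Hypothesis k0 : 0 < k.
Hypothesis a2 : a \in Lfun mu 2%:E.
Hypothesis g2 : g \in Lfun mu 2%:E.
Hypothesis ag : is_weak_partial i a g.

Local Notation e := (axis R i).
Local Notation ind t := (\1_`[0, k]%classic t : R).

Let k0' : 0 <= k. Proof. exact: ltW. Qed.
Let ma : measurable_fun setT a.
Proof. by move: a2; rewrite inE => /andP[/[!inE]]. Qed.
Let mg : measurable_fun setT g.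
Proof. by move: g2; rewrite inE => /andP[/[!inE]]. Qed.
Let ia : mu.-integrable setT (fun z => (a z ^+ 2)%:E).
Proof. exact: (Lfun2_integrable_sqr a2). Qed.
Let ig : mu.-integrable setT (fun z => (g z ^+ 2)%:E).
Proof. exact: (Lfun2_integrable_sqr g2). Qed.

(* The fundamental theorem of calculus along e: b z = a (z + k *: e) - a z a.e. *)
Let b (z : T1 * T1) : R := \int[mu1]_t (g (z + t *: e) * ind t).

Let mind : measurable_fun setT (\1_`[0, k]%classic : T1 -> R).
Proof. by []. Qed.

Let indM t : ind t * ind t = ind t.
Proof. by rewrite indicE; case: (_ \in _); rewrite ?mulr1 ?mulr0. Qed.

Let mH : measurable_fun setT (fun p : (T1 * T1) * T1 => (g (slide e p) * ind p.2)%:E).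
Proof. by apply/measurable_EFinP; exact: measurable_slide_fun. Qed.

Let mb : measurable_fun setT b.
Proof.
(* On a null set of z the slice may fail to be integrable. Splitting into positive and negative
   parts, each measurable by Tonelli's theorem, gives measurability at every z. *)
pose H (p : (T1 * T1) * T1) := (g (slide e p) * ind p.2)%:E.
have -> : b = fine \o ((fun z => \int[mu1]_t H^\+ (z, t)) \- (fun z => \int[mu1]_t H^\- (z, t)))%E.
  apply/funext => z; rewrite /b /Rintegral /= integralE; congr (fine (_ - _)%E).
    by apply: eq_integral => t _; rewrite !funeposE.
  by apply: eq_integral => t _; rewrite !funenegE.
apply: measurableT_comp => //; apply: emeasurable_funB.
  by apply: measurable_fun_fubini_tonelli_F => //; exact: measurable_funepos.
by apply: measurable_fun_fubini_tonelli_F => //; exact: measurable_funeneg.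
Qed.

Let iH2 : (mu \x mu1)%E.-integrable setT (fun p => (g (slide e p) ^+ 2 * ind p.2)%:E).
Proof. exact: (@integrable_slide R k e k0' (fun z => g z ^+ 2)). Qed.

Let mslice z : measurable_fun setT (fun t : T1 => g (z + t *: e)).
Proof.
apply: (measurableT_comp mg); apply/measurable_fun_pair.
  by apply: measurable_funD => //; exact: measurable_funM.
by apply: measurable_funD => //; exact: measurable_funM.
Qed.

(** By Fubini's theorem g^2 is integrable along almost every segment; there the Cauchy-Schwarz
    inequality applies. *)
Let ae_slice : {ae mu, forall z, mu1.-integrable setT (fun t => (g (z + t *: e) * ind t)%:E) /\
  ((b z ^+ 2)%:E <= k%:E * \int[mu1]_t (g (z + t *: e) ^+ 2 * ind t)%:E)%E}.
Proof.
have := ae_integrable1 iH2; apply: filterS => z h.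
have [h1 h2] := sqr_Rintegral_le k0' (mslice z) h.
split => //; rewrite -[X in (_ * X)%E]fineK; last exact: integrable_fin_num.
by rewrite -EFinM lee_fin.
Qed.

(** One factor k comes from the Cauchy-Schwarz inequality on segments, the other from integrating
    over t in [0, k] after Tonelli's theorem. *)
Let int_b2 : (\int[mu]_z (b z ^+ 2)%:E <= (k ^+ 2)%:E * \int[mu]_z (g z ^+ 2)%:E)%E.
Proof.
have mH2 : measurable_fun setT (fun p : (T1 * T1) * T1 => (g (slide e p) ^+ 2 * ind p.2)%:E).
  apply/measurable_EFinP; apply: (@measurable_slide_fun R k e (fun z => g z ^+ 2)).
  exact: measurable_funX.
have H0 : forall p : (T1 * T1) * T1, (0 <= (g (slide e p) ^+ 2 * ind p.2)%:E)%E.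
  by move=> p; rewrite lee_fin mulr_ge0// sqr_ge0.
have mF : measurable_fun setT (fun z : T1 * T1 => \int[mu1]_t (g (z + t *: e) ^+ 2 * ind t)%:E)%E.
  exact: (measurable_fun_fubini_tonelli_F _ mH2).
apply: (@le_trans _ _ (\int[mu]_z (k%:E * \int[mu1]_t (g (z + t *: e) ^+ 2 * ind t)%:E))%E).
  apply: ae_ge0_le_integral => //.
  - by move=> z _; rewrite lee_fin sqr_ge0.
  - by apply/measurable_EFinP; exact: measurable_funX.
  - move=> z _; rewrite mule_ge0 ?lee_fin//; apply: integral_ge0 => t _.
    exact: (H0 (z, t)).
  - exact: measurable_funeM.
  - by apply: (@filterS _ _ (ae_filter_ringOfSetsType mu) _ _ _ ae_slice) => z [_ h] _.
rewrite ge0_integralZl//; last first.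
  by move=> z _; apply: integral_ge0 => t _; exact: (H0 (z, t)).
rewrite (fubini_tonelli (fun p : (T1 * T1) * T1 => (g (slide e p) ^+ 2 * ind p.2)%:E))//.
rewrite (@ge0_integral_slide R k e k0' (fun z => g z ^+ 2)).
- by rewrite muleA -EFinM expr2.
- exact: measurable_funX.
- by move=> z; exact: sqr_ge0.
Qed.

Let ib2 : mu.-integrable setT (fun z => (b z ^+ 2)%:E).
Proof.
apply/integrableP; split; first by apply/measurable_EFinP; exact: measurable_funX.
under eq_integral do rewrite gee0_abs ?lee_fin ?sqr_ge0//.
apply: (le_lt_trans int_b2); rewrite lte_mul_pinfty ?lee_fin ?sqr_ge0//.
have /integrableP[_] := ig.
by under eq_integral do rewrite gee0_abs ?lee_fin ?sqr_ge0//.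
Qed.

Let mshift_a : measurable_fun setT (fun z : T1 * T1 => a (z + k *: e)).
Proof. exact: (measurableT_comp ma (measurable_shift (k *: e))). Qed.

Let ishift_a : mu.-integrable setT (fun z => (a (z + k *: e) ^+ 2)%:E).
Proof.
exact: (integrable_preserving (@measurable_shift R (k *: e))
  (@lebesgue2_shift R (k *: e)) ia).
Qed.

Section test.
Variables al be : R -> R.
Hypotheses (Bal : bump_function al) (Bbe : bump_function be).
Let phi := tensor al be.

Let mphi : measurable_fun setT (phi : T1 * T1 -> R).
Proof. exact: measurable_tensor. Qed.

Let iphi : mu.-integrable setT (fun z => (phi z ^+ 2)%:E).
Proof. exact: integrable_tensor_sqr. Qed.

Let iind_phi z : mu1.-integrable setT (fun t => (phi (z - t *: e) * ind t)%:E).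
Proof.
have [M phiM] := tensor_bounded Bal Bbe.
have ii : mu1.-integrable setT (fun t => (ind t)%:E).
  apply: integrable_indic_lty; first exact: measurable_itv.
  by have := @integral_indicE R k k0'; rewrite integral_indic//= setIT => ->; rewrite ltry.
apply: (@le_integrable _ _ R mu1 setT measurableT _ (fun t => M%:E * (ind t)%:E)%E).
- apply/measurable_EFinP; apply: measurable_funM => //.
  apply: (measurableT_comp mphi); apply/measurable_fun_pair.
    by apply: measurable_funB => //; exact: measurable_funM.
  by apply: measurable_funB => //; exact: measurable_funM.
- move=> t _; rewrite -EFinM /= lee_fin !normrM ler_wpM2r//.
  by rewrite -normrM; exact: (le_trans (phiM _) (ler_norm _)).
- exact: integrableZl.
Qed.

(** Integration along a segment has integration along the opposite segment as its adjoint: after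
    exchanging the integrals, z is translated by t e for each t. *)
Lemma Fubini_slide :
  \int[mu]_z (g z * \int[mu1]_(t in `[0, k]) phi (z - t *: e)) =
  \int[mu]_z (b z * phi z).
Proof.
(* The idempotent indicator is put into both factors, so that each is square integrable on the
   product with the t-axis. *)
pose H (p : (T1 * T1) * T1) : R := (g p.1 * ind p.2) * (phi (p.1 - p.2 *: e) * ind p.2).
pose H' (p : (T1 * T1) * T1) : R := (g (p.1 + p.2 *: e) * ind p.2) * (phi p.1 * ind p.2).
have slide0 p : slide (0 : R * R) p = p.1 by rewrite /slide scaler0 addr0.
have slideN p : slide (- e) p = p.1 - p.2 *: e by rewrite /slide scalerN.
have meas v (f : T1 * T1 -> R) : measurable_fun setT f ->
    measurable_fun setT (fun p => f (slide v p) * ind p.2).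
  exact: measurable_slide_fun.
have sqr v (f : T1 * T1 -> R) : mu.-integrable setT (fun z => (f z ^+ 2)%:E) ->
    (mu \x mu1)%E.-integrable setT (fun p => ((f (slide v p) * ind p.2) ^+ 2)%:E).
  move=> fi; have := @integrable_slide R k v k0' (fun z => f z ^+ 2) fi.
  by apply: eq_integrable => // p _; rewrite exprMn [in RHS](expr2 (ind _)) indM.
have iH : (mu \x mu1)%E.-integrable setT (EFin \o H).
  have := integrable_mul_sqr (meas 0 _ mg) (meas (- e) _ mphi) (sqr 0 _ ig) (sqr (- e) _ iphi).
  by apply: eq_integrable => // p _; rewrite /H slide0 slideN.
have iH' : (mu \x mu1)%E.-integrable setT (EFin \o H').
  have := integrable_mul_sqr (meas e _ mg) (meas 0 _ mphi) (sqr e _ ig) (sqr 0 _ iphi).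
  by apply: eq_integrable => // p _; rewrite /H' slide0.
congr fine.
transitivity (\int[mu]_z \int[mu1]_t (H (z, t))%:E)%E.
  apply: eq_integral => z _.
  have -> : (g z * \int[mu1]_(t in `[0, k]) phi (z - t *: e))%:E =
      ((g z)%:E * \int[mu1]_t (phi (z - t *: e) * ind t)%:E)%E.
    rewrite EFinM; congr (_ * _)%E; rewrite -[RHS]fineK; last first.
      by apply: integrable_fin_num => //; exact: iind_phi.
    congr EFin; rewrite Rintegral_mkcond; congr fine; apply: eq_integral => t _.
    by rewrite patchE indicE; case: ifPn => _; rewrite ?mulr1 ?mulr0.
  rewrite -integralZl//.
  by apply: eq_integral => t _; rewrite -EFinM /H/=; congr EFin; rewrite mulrACA indM mulrA.
rewrite (Fubini iH).
transitivity (\int[mu1]_t \int[mu]_z (H' (z, t))%:E)%E.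
  apply: eq_integral => t _.
  have mHt : measurable_fun setT (fun z : T1 * T1 => (H (z, t))%:E).
    apply/measurable_EFinP; apply: measurable_funM.
      by apply: measurable_funM; [exact: mg|exact: (measurable_cst (ind t))].
    apply: measurable_funM; last exact: (measurable_cst (ind t)).
    exact: (measurableT_comp mphi (measurable_shift (- (t *: e)))).
  rewrite -(integral_preserving (@measurable_shift R (t *: e))
     (@lebesgue2_shift R (t *: e)) mHt).
  by apply: eq_integral => z _; rewrite /H /H'/= addrK.
rewrite -(Fubini iH'); apply: ae_eq_integral => //.
- exact: (measurable_fubini_F iH').
- by apply/measurable_EFinP; exact: measurable_funM.
- apply: (@filterS _ _ (ae_filter_ringOfSetsType mu) _ _ _ ae_slice) => z [h _] _.
  rewrite mulrC EFinM /b /Rintegral fineK; last exact: integrable_fin_num.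
  rewrite -integralZl//; apply: eq_integral => t _; rewrite -EFinM /H'/=; congr EFin.
  by rewrite mulrACA indM [RHS]mulrCA mulrA.
Qed.

(** The weak derivative is tested against psi of [tensor_window]. Translation moves the difference
    from phi to a, and [Fubini_slide] moves the average from phi to g. *)
Lemma integral_difference_test :
  (\int[mu]_z ((a (z + k *: e) - a z - b z) * phi z)%:E = 0)%E.
Proof.
have i1 : mu.-integrable setT (EFin \o (fun z => a (z + k *: e) * phi z)).
  exact: integrable_mul_sqr.
have i2 : mu.-integrable setT (EFin \o (fun z => a z * phi z)).
  exact: integrable_mul_sqr.
have i3 : mu.-integrable setT (EFin \o (fun z => b z * phi z)).
  exact: integrable_mul_sqr.
have i12 : mu.-integrable setT (EFin \o (fun z => a (z + k *: e) * phi z - a z * phi z)).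
  by have := integrableB measurableT i1 i2; apply: eq_integrable.
have i123 : mu.-integrable setT
    (EFin \o (fun z => a (z + k *: e) * phi z - a z * phi z - b z * phi z)).
  by have := integrableB measurableT i12 i3; apply: eq_integrable.
have R0 : \int[mu]_z (a (z + k *: e) * phi z - a z * phi z - b z * phi z) = 0.
  rewrite RintegralB// RintegralB//.
  have [psi [Tpsi dpsi psiE]] := tensor_window i k0 Bal Bbe.
  have := ag Tpsi.
  under eq_Rintegral do rewrite dpsi mulrBr.
  have i4 : mu.-integrable setT (EFin \o (fun z => a z * phi (z - k *: e))).
    have := integrable_preserving (@measurable_shift R (- (k *: e)))
      (@lebesgue2_shift R (- (k *: e))) i1.
    by apply: eq_integrable => // z _ /=; rewrite subrK.
  rewrite RintegralB//.
  under [X in _ = - X]eq_Rintegral do rewrite psiE.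
  rewrite Fubini_slide.
  have -> : \int[mu]_z (a z * phi (z - k *: e)) = \int[mu]_z (a (z + k *: e) * phi z).
    congr fine.
    rewrite -(integral_preserving (@measurable_shift R (k *: e))
      (@lebesgue2_shift R (k *: e)) (measurable_int _ i4)).
    by apply: eq_integral => z _ /=; rewrite addrK.
  by move=> h; rewrite -[X in X - _]opprB h opprK subrr.
under eq_integral do rewrite !mulrBl.
rewrite -[LHS]fineK; last exact: integrable_fin_num.
by congr EFin.
Qed.

End test.

(** The function d is orthogonal to all product test functions, hence 0 almost everywhere, so that
    the bound on b applies to the difference. *)
Lemma weak_difference_quotient :
  (\int[mu]_z ((a (z + k *: e) - a z) ^+ 2)%:E <=
   (k ^+ 2)%:E * \int[mu]_z (g z ^+ 2)%:E)%E.
Proof.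
pose d (z : T1 * T1) := a (z + k *: e) - a z - b z.
have md : measurable_fun [set: T1 * T1] d.
  by apply: measurable_funB; [exact: measurable_funB|].
have id2 : mu.-integrable setT (fun z => (d z ^+ 2)%:E).
  have mN (f : T1 * T1 -> R) : measurable_fun setT f -> measurable_fun setT (\- f)%R.
    by move=> mf; exact: measurableT_comp.
  have iN (f : T1 * T1 -> R) : mu.-integrable setT (fun z => (f z ^+ 2)%:E) ->
      mu.-integrable setT (fun z => ((- f z) ^+ 2)%:E).
    by apply: eq_integrable => // z _; rewrite sqrrN.
  apply: integrableD_sqr; [|exact: mN| |exact: iN].
    by apply: measurable_funB.
  by apply: integrableD_sqr; [|exact: mN| |exact: iN].
have d0 : {ae mu, forall z, d z = 0}.
  apply: ae_eq0_test => //.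
    move=> l r l' r'.
    pose D : set (T1 * T1) := `[l, r]%classic `*` `[l', r']%classic.
    have mD : measurable D by apply: measurableX; exact: measurable_itv.
    apply/(integrable_mkcond _ mD).
    (* Local integrability of d: it is square integrable, and so is the indicator of the box. *)
    have iD : mu.-integrable setT (fun z => ((\1_D z) ^+ 2)%:E).
      have := integrable_indic_lty mD (lebesgue2_box_lty l r l' r').
      by apply: eq_integrable => // z _; rewrite indicE; case: (_ \in _); rewrite ?expr1n ?expr0n.
    have mi : measurable_fun setT (\1_D : T1 * T1 -> R) by exact: measurable_indic.
    have := integrable_mul_sqr md mi id2 iD.
    apply: eq_integrable => // z _.
    by rewrite patchE indicE; case: ifPn => _ /=; rewrite ?mulr1 ?mulr0.
  by move=> al be Bal Bbe; exact: integral_difference_test.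
apply: (le_trans _ int_b2); rewrite le_eqVlt; apply/orP; left; apply/eqP.
apply: ae_eq_integral => //.
- by apply/measurable_EFinP; apply: measurable_funX; exact: measurable_funB.
- by apply/measurable_EFinP; exact: measurable_funX.
- apply: (@filterS _ _ (ae_filter_ringOfSetsType mu) _ _ _ d0) => z dz _.
  by congr ((_ ^+ 2)%:E); apply/eqP; rewrite -subr_eq0; exact/eqP.
Qed.

End difference.

(** * The two-particle integral and the discrete Hardy inequality *)

Section product_integral.
Context d (T : measurableType d) (R : realType).
Variable mu : {sigma_finite_measure set T -> \bar R}.
Variables f g : T -> R.
Hypotheses (fi : mu.-integrable setT (EFin \o f)) (gi : mu.-integrable setT (EFin \o g)).

Let mf : measurable_fun setT f.
Proof. by apply/measurable_EFinP; exact: measurable_int fi. Qed.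
Let mg : measurable_fun setT g.
Proof. by apply/measurable_EFinP; exact: measurable_int gi. Qed.

Lemma integrable_tensor_prod :
  (mu \x mu)%E.-integrable setT (EFin \o (fun p => f p.1 * g p.2)).
Proof.
apply/integrable12ltyP.
  apply/measurable_EFinP; apply: measurable_funM.
    exact: (measurableT_comp mf measurable_fst).
  exact: (measurableT_comp mg measurable_snd).
have /integrableP[_ gi'] := gi; have /integrableP[_ fi'] := fi.
rewrite -[X in (X < _)%E]/(\int[mu]_x \int[mu]_y `|(f x * g y)%:E|)%E.
have -> : (\int[mu]_x \int[mu]_y `|(f x * g y)%:E| =
    \int[mu]_x (`|(f x)%:E| * \int[mu]_y `|(g y)%:E|))%E.
  apply: eq_integral => x _; rewrite -ge0_integralZl//.
  - by apply: eq_integral => y _; rewrite /= normrM EFinM.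
  - by apply: measurableT_comp => //; exact/measurable_EFinP.
rewrite ge0_integralZr//.
- by apply: lte_mul_pinfty; [exact: integral_ge0|
    rewrite ge0_fin_numE//; exact: integral_ge0|].
- by apply: measurableT_comp => //; exact/measurable_EFinP.
- exact: integral_ge0.
Qed.

Lemma Rintegral_tensor_prod :
  \int[(mu \x mu)%E]_p (f p.1 * g p.2) = \int[mu]_x f x * \int[mu]_y g y.
Proof.
rewrite /Rintegral -fineM ?integrable_fin_num//; congr fine.
rewrite -(integral12_prod_meas1 integrable_tensor_prod).
transitivity (\int[mu]_x ((f x)%:E * \int[mu]_y (g y)%:E))%E.
  apply: eq_integral => x _; rewrite -integralZl//.
have gfin : (\int[mu]_y (g y)%:E)%E \is a fin_num by exact: integrable_fin_num.
by rewrite -(fineK gfin) integralZr.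
Qed.

End product_integral.

Section double_integral.
Variable R : realType.
Local Notation mu := (@lebesgue2 R).
Local Notation T1 := (measurableTypeR R).
Local Notation T2 := (T1 * T1)%type.
Local Notation nu := (@lebesgue2 R \x @lebesgue2 R)%E.
Variables (w : T2 -> R) (e : R * R) (k g B : R) (F : T2 -> R).
Hypotheses (mw : measurable_fun setT w)
  (w2 : mu.-integrable setT (fun x => (w x ^+ 2)%:E)).
Hypotheses (k0 : 0 < k)
  (wg : (\int[mu]_x ((w (x + k *: e) - w x) ^+ 2)%:E <= (k ^+ 2 * g)%:E)%E).
Hypotheses (mF : measurable_fun setT F) (FB : forall z, `|F z| <= B).
Let M := \int[mu]_x (w x ^+ 2).
Let rho (x : T2) : R := w x ^+ 2.

Let mshift v : measurable_fun setT (fun x : T2 => w (x + v)).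
Proof. exact: (measurableT_comp mw (measurable_shift v)). Qed.

Let ishift v : mu.-integrable setT (fun x => (w (x + v) ^+ 2)%:E).
Proof.
exact: (integrable_preserving (@measurable_shift R v) (@lebesgue2_shift R v) w2).
Qed.

Let Rint_shift v (f : T2 -> R) : measurable_fun setT f ->
  \int[mu]_x f (x + v) = \int[mu]_x f x.
Proof.
move=> mf; congr fine.
apply: (integral_preserving (@measurable_shift R v) (@lebesgue2_shift R v) (f := EFin \o f)).
exact/measurable_EFinP.
Qed.

Let c := \int[mu]_x (w (x - k *: e) * w x).

Let i_c v : mu.-integrable setT (EFin \o (fun x => w (x + v) * w x)).
Proof. exact: integrable_mul_sqr. Qed.

Let cE : \int[mu]_x (w (x + k *: e) * w x) = c.
Proof.
rewrite /c -(Rint_shift (k *: e) (f := fun x => w (x - k *: e) * w x)).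
  by apply: eq_Rintegral => x _; rewrite addrK mulrC.
by apply: measurable_funM => //; exact: mshift.
Qed.

Let iZ d (T : measurableType d) (m : {measure set T -> \bar R}) (r : R) (f : T -> R) :
  m.-integrable setT (EFin \o f) -> m.-integrable setT (EFin \o (fun x => r * f x)).
Proof.
by move=> fi; have := integrableZl measurableT r fi; apply: eq_integrable.
Qed.

Let iD d (T : measurableType d) (m : {measure set T -> \bar R}) (f h : T -> R) :
  m.-integrable setT (EFin \o f) -> m.-integrable setT (EFin \o h) ->
  m.-integrable setT (EFin \o (fun x => f x + h x)).
Proof.
by move=> fi hi; have := integrableD measurableT fi hi; apply: eq_integrable.
Qed.

Let iB d (T : measurableType d) (m : {measure set T -> \bar R}) (f h : T -> R) :
  m.-integrable setT (EFin \o f) -> m.-integrable setT (EFin \o h) ->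
  m.-integrable setT (EFin \o (fun x => f x - h x)).
Proof.
by move=> fi hi; have := integrableB measurableT fi hi; apply: eq_integrable.
Qed.

(** The middle term is the squared L^2 distance between w and its translate. *)
Let MC : 0 <= 2 * (M - c) <= k ^+ 2 * g.
Proof.
have E : \int[mu]_x ((w (x + k *: e) - w x) ^+ 2) = 2 * (M - c).
  transitivity (\int[mu]_x (w (x + k *: e) ^+ 2 - 2 * (w (x + k *: e) * w x) + w x ^+ 2)).
    by apply: eq_Rintegral => x _; ring.
  rewrite RintegralD//; last by apply: iB; [exact: ishift|apply: iZ; exact: i_c].
  rewrite RintegralB//; [|exact: ishift|by apply: iZ; exact: i_c].
  rewrite RintegralZl//.
  rewrite (Rint_shift (k *: e) (f := fun x => w x ^+ 2)); last exact: measurable_funX.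
  by rewrite cE -/M; ring.
rewrite -E Rintegral_ge0/=; last by move=> x _; exact: sqr_ge0.
rewrite -lee_fin (le_trans _ wg)// /Rintegral fineK// ge0_fin_numE.
  exact: (le_lt_trans wg (ltry _)).
by apply: integral_ge0 => x _; rewrite lee_fin sqr_ge0.
Qed.

(* V p is U at p shifted by (- v, v), a shift of the relative coordinate z by
   - 2 v. *)
Let v := k *: e.
Let U (p : T2 * T2) := w p.1 * w p.2.
Let V (p : T2 * T2) := w (p.1 - v) * w (p.2 + v).
Let W (p : T2 * T2) : R := rho p.1 * rho p.2.
Let z (p : T2 * T2) : T2 := p.1 - p.2.

Let irho : mu.-integrable setT (EFin \o rho).
Proof. exact: w2. Qed.

Let iW : nu.-integrable setT (EFin \o W).
Proof. exact: integrable_tensor_prod. Qed.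

Let iVV : nu.-integrable setT (EFin \o (fun p => V p ^+ 2)).
Proof.
have := @integrable_tensor_prod _ _ R (@lebesgue2 R) (fun x => rho (x - v)) (fun x => rho (x + v))
  (ishift (- v)) (ishift v).
by apply: eq_integrable => // p _ /=; rewrite /V exprMn.
Qed.

Let iUV : nu.-integrable setT (EFin \o (fun p => V p * U p)).
Proof.
have := @integrable_tensor_prod _ _ R (@lebesgue2 R) _ _ (i_c (- v)) (i_c v).
by apply: eq_integrable => // p _ /=; rewrite /V /U mulrACA.
Qed.

Let i_diff : nu.-integrable setT (EFin \o (fun p => (V p - U p) ^+ 2)).
Proof.
have := iD (iB iVV (iZ 2 iUV)) iW.
by apply: eq_integrable => // p _ /=; congr EFin; rewrite /W /rho /U; ring.
Qed.

Let int_diff : \int[nu]_p ((V p - U p) ^+ 2) = 2 * M ^+ 2 - 2 * c ^+ 2.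
Proof.
transitivity (\int[nu]_p (V p ^+ 2 - 2 * (V p * U p) + W p)).
  by apply: eq_Rintegral => p _; rewrite /U /W /rho; ring.
rewrite RintegralD//; last by apply: iB => //; exact: iZ.
rewrite RintegralB//; last exact: iZ.
rewrite RintegralZl//.
have -> : \int[nu]_p W p = M * M by exact: Rintegral_tensor_prod.
have -> : \int[nu]_p (V p ^+ 2) = M * M.
  transitivity (\int[nu]_p (rho (p.1 - v) * rho (p.2 + v))).
    by apply: eq_Rintegral => p _; rewrite /V exprMn.
  rewrite (Rintegral_tensor_prod (ishift (- v)) (ishift v)).
  have mr : measurable_fun setT rho by exact: measurable_funX.
  by rewrite (Rint_shift (- v) mr) (Rint_shift v mr).
have -> : \int[nu]_p (V p * U p) = c * c.
  transitivity (\int[nu]_p ((w (p.1 - v) * w p.1) * (w (p.2 + v) * w p.2))).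
    by apply: eq_Rintegral => p _; rewrite /V /U mulrACA.
  by rewrite (Rintegral_tensor_prod (i_c (- v)) (i_c v)) cE.
by ring.
Qed.

(** By 2 M^2 - 2 c^2 = 2 M * 2 (M - c) - 2 (M - c)^2 and the bound on 2 (M - c). Divided by (2 k)^2,
    the squared displacement of z, it gives the constant M g / 2. *)
Let int_diff_le : \int[nu]_p ((V p - U p) ^+ 2) <= 2 * k ^+ 2 * g * M.
Proof.
have M0 : 0 <= M by apply: Rintegral_ge0 => x _; exact: sqr_ge0.
rewrite int_diff; case/andP: MC => h1 h2; move: (k ^+ 2) h2 => K.
move: M c M0 h1 => m c' m0 h1 h2; rewrite -subr_ge0.
have -> : 2 * K * g * m - (2 * m ^+ 2 - 2 * c' ^+ 2) =
  2 * m * (K * g - 2 * (m - c')) + 2 * (m - c') ^+ 2 by ring.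
apply: addr_ge0; last by rewrite mulr_ge0 ?sqr_ge0.
by apply: mulr_ge0; [rewrite mulr_ge0|rewrite subr_ge0].
Qed.

Let mz : measurable_fun setT z.
Proof. exact: measurable_subpair. Qed.

Let iWF (Psi : T2 -> R) (H : T2 * T2 -> R) (C : R) :
  measurable_fun setT Psi -> (forall y, `|Psi y| <= C) ->
  nu.-integrable setT (EFin \o H) ->
  nu.-integrable setT (EFin \o (fun p => H p * Psi (z p))).
Proof.
move=> mPsi PsiC iH.
have mH : measurable_fun setT H by apply/measurable_EFinP; exact: measurable_int iH.
apply: (@le_integrable _ _ R nu setT measurableT _ (EFin \o (fun p => C * H p))).
- apply/measurable_EFinP; apply: measurable_funM => //.
  exact: (measurableT_comp mPsi mz).
- move=> p _; rewrite /= lee_fin !normrM mulrC ler_wpM2r//.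
  exact: (le_trans (PsiC _) (ler_norm _)).
- exact: iZ.
Qed.

(** It undoes the shift: V (shear p) = U p and z (shear p) = z p + 2 v. *)
Let shear (p : T2 * T2) : T2 * T2 := (p.1 + v, p.2 - v).

Let Rint_shear (H : T2 * T2 -> R) : measurable_fun setT H ->
  \int[nu]_p H (shear p) = \int[nu]_p H p.
Proof.
move=> mH; congr fine.
apply: (@integral_preserving _ _ R nu shear _ _ (EFin \o H)).
- exact: (measurable_map_pair (measurable_shift v) (measurable_shift (- v))).
- exact: (product_measure_map_pair (measurable_shift v) (measurable_shift (- v))
    (@lebesgue2_shift R v) (@lebesgue2_shift R (- v))).
- exact/measurable_EFinP.
Qed.

(** A discrete form, at step 2 k, of the derivative of F along e minus F^2. Averaging the square
    over both ends is what lets the integrand be compared by an exact sum of squares. *)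
Definition quotient_energy (y : T2) : R :=
  (F (y + (2 * k) *: e) - F y) / (2 * k) - (F (y + (2 * k) *: e) ^+ 2 + F y ^+ 2) / 2.

Lemma double_integral_quotient_le :
  nu.-integrable setT (EFin \o (fun p => rho p.1 * rho p.2 * quotient_energy (p.1 - p.2))) /\
  \int[nu]_p (rho p.1 * rho p.2 * quotient_energy (p.1 - p.2)) <= M * g / 2.
Proof.
(* [quotient_energy] is P1 at the shifted point minus P2 at y. Under [shear] the first term gets the
   weight V^2 in place of U^2 = W, a summation by parts. *)
pose P1 (y : T2) : R := F y / (2 * k) - F y ^+ 2 / 2.
pose P2 (y : T2) : R := F y / (2 * k) + F y ^+ 2 / 2.
have B0 : 0 <= B by exact: le_trans (FB 0).
have k20 : 0 < 2 * k by rewrite mulr_gt0.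
have k2i : 0 < (2 * k)^-1 by rewrite invr_gt0.
have F2 y : F y ^+ 2 <= B ^+ 2 by rewrite -[F y ^+ 2]real_normK ?num_real// lerXn2r ?nnegrE.
have P1B y : `|P1 y| <= B / (2 * k) + B ^+ 2 / 2.
  rewrite (le_trans (ler_normB _ _))// lerD// normrM.
    by rewrite (gtr0_norm k2i) ler_pM2r.
  by rewrite ger0_norm ?sqr_ge0// ger0_norm// ler_pM2r.
have P2B y : `|P2 y| <= B / (2 * k) + B ^+ 2 / 2.
  rewrite (le_trans (ler_normD _ _))// lerD// normrM.
    by rewrite (gtr0_norm k2i) ler_pM2r.
  by rewrite ger0_norm ?sqr_ge0// ger0_norm// ler_pM2r.
have mP1 : measurable_fun setT P1.
  by apply: measurable_funB; apply: measurable_funM => //; exact: measurable_funX.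
have mP2 : measurable_fun setT P2.
  by apply: measurable_funD; apply: measurable_funM => //; exact: measurable_funX.
have mP1s : measurable_fun setT (fun y : T2 => P1 (y + (2 * k) *: e)).
  exact: (measurableT_comp mP1 (measurable_shift _)).
have i1 := iWF mP1 P1B iVV.
have i1s := @iWF _ _ _ mP1s (fun y => P1B _) iW.
have i2 := iWF mP2 P2B iW.
have EQ p : rho p.1 * rho p.2 * quotient_energy (p.1 - p.2) =
    W p * P1 (z p + (2 * k) *: e) - W p * P2 (z p).
  by rewrite /quotient_energy /W /P1 /P2 /z; field; rewrite gt_eqF.
have E1 : \int[nu]_p (W p * P1 (z p + (2 * k) *: e)) = \int[nu]_p (V p ^+ 2 * P1 (z p)).
  rewrite -(@Rint_shear (fun p => V p ^+ 2 * P1 (z p))); last first.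
    by apply/measurable_EFinP; exact: measurable_int i1.
  apply: eq_Rintegral => p _; rewrite /W /V /z /rho /shear /= addrK subrK exprMn.
  congr (_ * P1 _); rewrite -[2]/(1 + 1) mulrDl mul1r scalerDl -/v.
  by rewrite opprB [RHS]addrA [LHS]addrAC [in LHS]addrA.
split; first by have := iB i1s i2; apply: eq_integrable => // p _ /=; rewrite EQ.
under eq_Rintegral do rewrite EQ.
rewrite RintegralB// E1 -RintegralB//.
apply: (@le_trans _ _ (\int[nu]_p ((V p - U p) ^+ 2 / (4 * k ^+ 2)))).
  apply: le_Rintegral => //; first exact: iB.
    have := iZ ((4 * k ^+ 2)^-1) i_diff.
    by apply: eq_integrable => // p _ /=; rewrite mulrC.
  move=> p _; rewrite /W /rho -exprMn -/(U p) /P1 /P2.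
  (* (x^2 - y^2) f / (2 k) = ((x - y) / k) ((x + y) / 2) f, and
     ((x + y) / 2)^2 = (x^2 + y^2) / 2 - ((x - y) / 2)^2. *)
  set x := V p; set y := U p; set f := F _.
  rewrite -subr_ge0.
  have -> : (x - y) ^+ 2 / (4 * k ^+ 2) - (x ^+ 2 * (f / (2 * k) - f ^+ 2 / 2)
      - y ^+ 2 * (f / (2 * k) + f ^+ 2 / 2)) =
    ((x - y) / (2 * k) - (x + y) * f / 2) ^+ 2 + ((x - y) * f / 2) ^+ 2.
    by field; rewrite gt_eqF.
  by rewrite addr_ge0// sqr_ge0.
rewrite RintegralZr//.
rewrite ler_pdivrMr ?mulr_gt0 ?exprn_gt0//.
rewrite (le_trans int_diff_le)// le_eqVlt; apply/orP; left; apply/eqP; by field.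
Qed.

End double_integral.

Lemma measurable_ln_distance (R : realType) :
  let T2 := (measurableTypeR R * measurableTypeR R)%type in
  measurable_fun setT (fun p : T2 * T2 => ln (enorm (p.1 - p.2))).
Proof.
apply: (measurableT_comp (@measurable_ln R)).
exact: (measurableT_comp (@measurable_enorm R) (@measurable_subpair R)).
Qed.

(** * The bound on the logarithmic energy *)

Section logarithmic_energy.
Variable R : realType.
Local Notation mu := (@lebesgue2 R).
Local Notation T1 := (measurableTypeR R).
Local Notation T2 := (T1 * T1)%type.
Local Notation nu := (@lebesgue2 R \x @lebesgue2 R)%E.
Variables (w : T2 -> R) (g : 'I_2 -> R) (l : R).
Hypotheses (mw : measurable_fun setT w)
  (w2 : mu.-integrable setT (fun x => (w x ^+ 2)%:E)).
Hypothesis wg : forall i (k : R), 0 < k ->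
  (\int[mu]_x ((w (x + k *: axis R i) - w x) ^+ 2)%:E <= (k ^+ 2 * g i)%:E)%E.
Hypothesis l0 : 0 < l.

Let M := \int[mu]_x (w x ^+ 2).
Let G := \sum_(i < 2) g i.
Let rho (x : T2) : R := w x ^+ 2.
Let W (p : T2 * T2) : R := rho p.1 * rho p.2.
Let z (p : T2 * T2) : T2 := p.1 - p.2.
Let B := l * (5 / 3).
(** Each of the two summands of Q is at least - B^2, so adding C makes Q nonnegative. The constant
    cancels in [log_energy_le]. *)
Let C := 2 * B ^+ 2.
(** Half of 1 / (n+1), because the relative coordinate moves by 2 k. *)
Let k n : R := n.+1%:R^-1 / 2.
Let q n i (y : T2) : R := quotient_energy (axis R i) (k n) (vfield l i) y.
Let Q n (y : T2) : R := \sum_(i < 2) q n i y + C.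

Let rho_ge0 x : 0 <= rho x. Proof. exact: sqr_ge0. Qed.
Let W_ge0 p : 0 <= W p. Proof. by rewrite mulr_ge0. Qed.
Let k_gt0 n : 0 < k n. Proof. by rewrite divr_gt0 ?invr_gt0. Qed.
Let k2 n : 2 * k n = n.+1%:R^-1. Proof. by rewrite /k mulrC divfK. Qed.

Let irho : mu.-integrable setT (EFin \o rho).
Proof. exact: w2. Qed.

Let iW : nu.-integrable setT (EFin \o W).
Proof. exact: integrable_tensor_prod. Qed.

Let intW : \int[nu]_p W p = M ^+ 2.
Proof. by rewrite (Rintegral_tensor_prod irho irho) expr2. Qed.

Let mz : measurable_fun setT z.
Proof. exact: measurable_subpair. Qed.

Let q_ge n i y : - B ^+ 2 <= q n i y.
Proof.
have l0' := ltW l0.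
have F2 x : vfield l i x ^+ 2 <= B ^+ 2.
  rewrite -[vfield l i x ^+ 2]real_normK ?num_real// lerXn2r ?nnegrE//.
    by rewrite mulr_ge0.
  exact: field_bounded.
have h1 : 0 <= (vfield l i (y + (2 * k n) *: axis R i) - vfield l i y) / (2 * k n).
  rewrite divr_ge0 ?mulr_ge0 ?(ltW (k_gt0 n))// subr_ge0 field_nondecreasing//.
  by rewrite mulr_ge0// ltW.
rewrite /q /quotient_energy; have := F2 y; have := F2 (y + (2 * k n) *: axis R i).
move: (_ / (2 * k n)) h1 (vfield l i y ^+ 2) (vfield l i _ ^+ 2) (B ^+ 2) => x x0 a b c.
by move=> ? ?; lra.
Qed.

Let Q_ge0 n y : 0 <= Q n y.
Proof.
rewrite /Q big_ord_recl big_ord1; have := q_ge n ord0 y.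
have := q_ge n (lift ord0 ord0) y; rewrite /C.
by move: (q _ _ _) (q _ _ _) (B ^+ 2) => a b c; lra.
Qed.

Let quotient_le n i :
  nu.-integrable setT (EFin \o (fun p => W p * q n i (z p))) /\
  \int[nu]_p (W p * q n i (z p)) <= M * g i / 2.
Proof.
apply: (@double_integral_quotient_le R w (axis R i) (k n) (g i) B (vfield l i)) => //.
- exact: wg.
- exact: measurable_field.
- by move=> x; apply: field_bounded; exact: ltW.
Qed.

Let iWQ n : nu.-integrable setT (EFin \o (fun p => W p * Q n (z p))).
Proof.
have := integrableD measurableT (integrableD measurableT (quotient_le n ord0).1
  (quotient_le n (lift ord0 ord0)).1) (integrableZl measurableT C iW).
apply: eq_integrable => // p _ /=; rewrite -EFinM -!EFinD /Q big_ord_recl big_ord1.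
by congr EFin; ring.
Qed.

Let int_WQ n : (\int[nu]_p (W p * Q n (z p))%:E <= (M * G / 2 + C * M ^+ 2)%:E)%E.
Proof.
rewrite -[leLHS]fineK; last exact: integrable_fin_num (iWQ n).
rewrite lee_fin -[leLHS]/(\int[nu]_p (W p * Q n (z p))).
have [i0 h0] := quotient_le n ord0.
have [i1 h1] := quotient_le n (lift ord0 ord0).
have i01 : nu.-integrable setT (EFin \o
   (fun p => W p * q n ord0 (z p) + W p * q n (lift ord0 ord0) (z p))).
  by have := integrableD measurableT i0 i1; apply: eq_integrable.
have iC : nu.-integrable setT (EFin \o (fun p => C * W p)).
  by have := integrableZl measurableT C iW; apply: eq_integrable.
apply: (@le_trans _ _ (\int[nu]_p
    (W p * q n ord0 (z p) + W p * q n (lift ord0 ord0) (z p) + C * W p))).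
  rewrite le_eqVlt; apply/orP; left; apply/eqP; apply: eq_Rintegral => p _.
  by rewrite /Q big_ord_recl big_ord1; ring.
rewrite RintegralD// RintegralD// RintegralZl// intW lerD2r.
by rewrite /G big_ord_recl big_ord1 mulrDr mulrDl lerD.
Qed.

Let N : set (T2 * T2) := [set p | z p = 0].

Let mdiag : measurable N.
Proof.
rewrite (_ : N = z @^-1` ([set 0] `*` [set 0])).
  rewrite -[X in measurable X]setTI; apply: mz => //.
  by apply: measurableX; exact: measurable_set1.
apply/seteqP; split => p => [h|[h1 h2]].
  by split; [exact: (congr1 fst h)|exact: (congr1 snd h)].
exact: (etrans (surjective_pairing (z p)) (congr2 pair h1 h2)).
Qed.

(** The limit of Q is available off the diagonal only, as F is singular at 0. The sections of the
    diagonal are points. *)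
Let nu_diag : nu N = 0%E.
Proof.
rewrite -[LHS]/(\int[mu]_x mu (xsection N x))%E.
apply: integral0_eq => x _.
rewrite (_ : xsection _ x = [set x.1] `*` [set x.2]).
  rewrite -[LHS]/((@lebesgue_measure R \x @lebesgue_measure R)%E ([set x.1] `*` [set x.2])).
  by rewrite product_measure1E// [X in (X * _)%E]lebesgue_measure_set1 mul0e.
apply/seteqP; split => y; rewrite /xsection /= inE => h.
  by have /eqP : x - y = 0 := h; rewrite subr_eq0 => /eqP ->.
suff : x - y = 0 by [].
have [h1 h2] := h.
by apply: (etrans (surjective_pairing (x - y))); congr pair; rewrite /= ?h1 ?h2 subrr.
Qed.

Let V (y : T2) : R := \sum_(i < 2) (dvfield l i y - vfield l i y ^+ 2) + C.

Let cvg_q i y : y != 0 -> q n i y @[n --> \oo] --> dvfield l i y - vfield l i y ^+ 2.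
Proof.
move=> y0; have cq := @cvg_field_quotient R l i y l0 y0.
(* Continuity along the axis is read off from the convergence of the difference quotients. *)
have cF : vfield l i (y + n.+1%:R^-1 *: axis R i) @[n --> \oo] --> vfield l i y.
  have c1 : vfield l i y + n.+1%:R^-1 * ((vfield l i (y + n.+1%:R^-1 *: axis R i) -
      vfield l i y) / n.+1%:R^-1) @[n --> \oo] --> vfield l i y + 0 * dvfield l i y.
    by apply: cvgD; [exact: cvg_cst|apply: cvgM; [exact: cvg_harmonic|exact: cq]].
  rewrite mul0r addr0 in c1; apply: cvg_trans c1; apply: near_eq_cvg; apply: nearW => n.
  by rewrite mulrC divfK ?invr_eq0 ?pnatr_eq0// addrC subrK.
have cF2 : (vfield l i (y + n.+1%:R^-1 *: axis R i) ^+ 2 + vfield l i y ^+ 2) / 2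
    @[n --> \oo] --> (vfield l i y ^+ 2 + vfield l i y ^+ 2) / 2.
  by apply: cvgMl; apply: cvgD; [apply: cvgM; exact: cF|exact: cvg_cst].
rewrite (_ : (_ + _) / 2 = vfield l i y ^+ 2) in cF2; last by field.
have c2 : (vfield l i (y + n.+1%:R^-1 *: axis R i) - vfield l i y) / n.+1%:R^-1 -
    (vfield l i (y + n.+1%:R^-1 *: axis R i) ^+ 2 + vfield l i y ^+ 2) / 2
    @[n --> \oo] --> dvfield l i y - vfield l i y ^+ 2 by exact: cvgB.
apply: cvg_trans c2; apply: near_eq_cvg; apply: nearW => n.
by rewrite /q /quotient_energy !k2.
Qed.

Let cvg_Q y : y != 0 -> Q n y @[n --> \oo] --> V y.
Proof.
move=> y0; rewrite /V /Q big_ord_recl big_ord1.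
under eq_cvg do rewrite big_ord_recl big_ord1.
by apply: cvgD; [apply: cvgD; exact: cvg_q|exact: cvg_cst].
Qed.

Let V_ge0 y : y != 0 -> 0 <= V y.
Proof.
move=> y0; rewrite -(cvg_lim (@Rhausdorff R) (cvg_Q y0)); apply: limr_ge.
  by apply/cvg_ex; eexists; exact: (cvg_Q y0).
exact: nearW.
Qed.

Let K := M * G / 2 + C * M ^+ 2.

Let mWQ n : measurable_fun setT (fun p => (W p * Q n (z p))%:E).
Proof. exact: measurable_int (iWQ n). Qed.

Let Dc : set (T2 * T2) := setT `\` N.

Let mDc : measurable Dc. Proof. exact: measurableD. Qed.

Let cvg_WQ p : Dc p -> (W p * Q n (z p))%:E @[n --> \oo] --> (W p * V (z p))%:E.
Proof.
move=> [_ /eqP p0]; apply: cvg_EFin; first exact: nearW.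
by apply: cvgMr; exact: cvg_Q.
Qed.

(* Fatou's lemma applies since F is nondecreasing along the axes and bounded. *)
Let int_WV : (\int[nu]_(p in Dc) (W p * V (z p))%:E <= K%:E)%E.
Proof.
have mf n : measurable_fun Dc (fun p => (W p * Q n (z p))%:E).
  exact: measurable_funTS.
have f0 n p : Dc p -> (0 <= (W p * Q n (z p))%:E)%E.
  by move=> _; rewrite lee_fin mulr_ge0.
have := fatou nu mDc mf f0.
under eq_integral => p /set_mem Dp do rewrite (cvg_limn_einf_sup (cvg_WQ Dp)).1.
move=> h; apply: (le_trans h); rewrite limn_einf_lim; apply: lime_le.
  exact: is_cvg_einfs.
apply: nearW => n; apply: (@le_trans _ _ (\int[nu]_(p in Dc) (W p * Q n (z p))%:E)%E).
  by apply: ereal_inf_lbound; exists n => /=.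
apply: (le_trans _ (int_WQ n)); apply: ge0_subset_integral => //.
by move=> p _; rewrite lee_fin mulr_ge0.
Qed.

Let c0 := l ^+ 2 * (1 / 2 - ln l) + C.
Let lg (p : T2 * T2) : R := ln (enorm (z p)).
(** Far from the diagonal c0 - l^2 ln |z| is negative and possibly not integrable against W. Since V
    is nonnegative and dominates it, W V dominates the positive part as well, whose integral is
    therefore finite. *)
Let L (p : T2 * T2) : R := W p * Num.max 0 (c0 - l ^+ 2 * lg p).

Let mW : measurable_fun setT W.
Proof. by apply/measurable_EFinP; exact: measurable_int iW. Qed.

Let mlg : measurable_fun setT lg.
Proof. exact: measurable_ln_distance. Qed.

Let mL : measurable_fun setT L.
Proof.
apply: measurable_funM => //; apply: measurable_maxr => //.
by apply: measurable_funB => //; exact: measurable_funM.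
Qed.

Let int_L : (\int[nu]_p (L p)%:E <= K%:E)%E.
Proof.
have L0 p : (0 <= (L p)%:E)%E by rewrite lee_fin mulr_ge0// le_max lexx.
rewrite (@ge0_negligible_integral _ _ _ nu setT N)//; last exact/measurable_EFinP.
apply: (le_trans _ int_WV); apply: ge0_le_integral => //.
- by apply/measurable_EFinP; exact: measurable_funTS.
- apply: (emeasurable_fun_cvg (fun n p => (W p * Q n (z p))%:E)) => //.
    by move=> n; exact: measurable_funTS.
- move=> p [_ /eqP p0]; rewrite lee_fin ler_wpM2l// ge_max V_ge0//=.
  rewrite /c0 addrAC lerD2r (le_trans _ (field_ineq l0 p0))//.
  by rewrite -mulrBr.
Qed.

Let ell (p : T2 * T2) : R := rho p.1 * ln (enorm (p.1 - p.2)) * rho p.2.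

Let ellE p : ell p = W p * lg p.
Proof. by rewrite /ell /W mulrAC. Qed.

Let mell : measurable_fun setT (EFin \o ell).
Proof.
apply/measurable_EFinP; rewrite (_ : ell = W \* lg); first exact: measurable_funM.
by apply/funext => p; rewrite ellE.
Qed.

Let iL : nu.-integrable setT (EFin \o L).
Proof.
apply/integrableP; split; first exact/measurable_EFinP.
apply: le_lt_trans (ltry K); apply: le_trans int_L; apply: ge0_le_integral => //.
- by apply: measurableT_comp => //; exact/measurable_EFinP.
- exact/measurable_EFinP.
- by move=> p _ /=; rewrite lee_fin ger0_norm// mulr_ge0// le_max lexx.
Qed.

(** By - l^2 ell = W (c0 - l^2 lg) - c0 W <= L + |c0| W, where both terms are integrable. *)
Lemma log_energy_neg_lty : (\int[nu]_p (EFin \o ell)^\- p < +oo)%E.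
Proof.
have iU : nu.-integrable setT (fun p => (l ^- 2 * (L p + `|c0| * W p))%:E).
  have := integrableZl measurableT (l ^- 2)
    (integrableD measurableT iL (integrableZl measurableT `|c0| iW)).
  by apply: eq_integrable.
have /integrableP[mU iU'] := iU.
apply: le_lt_trans iU'; apply: ge0_le_integral => //.
- exact: measurable_funeneg.
- by apply: measurableT_comp.
- move=> p _; rewrite funenegE /= -EFin_max lee_fin.
  apply: (le_trans _ (ler_norm _)).
  have l2 : 0 < l ^+ 2 by rewrite exprn_gt0.
  have L0 : 0 <= L p by rewrite mulr_ge0// le_max lexx.
  rewrite ge_max; apply/andP; split; last first.
    by rewrite mulr_ge0 ?invr_ge0 ?(ltW l2)// addr_ge0// mulr_ge0.
  rewrite ler_pdivlMl// ellE.
  have h1 : W p * (c0 - l ^+ 2 * lg p) <= L p by rewrite ler_wpM2l// le_max lexx orbT.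
  have h2 : - c0 * W p <= `|c0| * W p by rewrite ler_wpM2r// -normrN ler_norm.
  rewrite (le_trans _ (lerD h1 h2))// le_eqVlt; apply/orP; left; apply/eqP; ring.
Qed.

Lemma log_energy_le :
  (- (\int[nu]_p (ell p)%:E) <=
   (M ^+ 2 * (ln l - 1 / 2) + M * G / (2 * l ^+ 2))%:E)%E.
Proof.
have Nlty := log_energy_neg_lty.
have N0 : (0 <= \int[nu]_p (EFin \o ell)^\- p)%E by exact: integral_ge0.
have P0 : (0 <= \int[nu]_p (EFin \o ell)^\+ p)%E by exact: integral_ge0.
(* If the positive part has an infinite integral, the left side is -oo. Otherwise [ell] is
   integrable, and integrating W (c0 - l^2 lg) <= L suffices. *)
have [Plty|] := ltP (\int[nu]_p (EFin \o ell)^\+ p)%E +oo%E; last first.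
  rewrite leye_eq => /eqP Py.
  rewrite integralE Py; move: Nlty N0; case: (\int[nu]_p _)%E => //= r _ _.
  by rewrite leNye.
have iell : nu.-integrable setT (EFin \o ell).
  apply/integrableP; split => //.
  rewrite -[X in (X < _)%E]/(\int[nu]_p (abse \o (EFin \o ell)) p)%E fune_abse.
  rewrite ge0_integralD//; [exact: lte_add_pinfty|exact: measurable_funepos|
    exact: measurable_funeneg].
have i1 : nu.-integrable setT (EFin \o (fun p => c0 * W p)).
  by have := integrableZl measurableT c0 iW; apply: eq_integrable.
have i2 : nu.-integrable setT (EFin \o (fun p => l ^+ 2 * ell p)).
  by have := integrableZl measurableT (l ^+ 2) iell; apply: eq_integrable.
have : \int[nu]_p (c0 * W p - l ^+ 2 * ell p) <= K.
  apply: (@le_trans _ _ (\int[nu]_p (L p))).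
    apply: le_Rintegral => //.
      by have := integrableB measurableT i1 i2; apply: eq_integrable.
    move=> p _; rewrite ellE /L.
    have -> : c0 * W p - l ^+ 2 * (W p * lg p) = W p * (c0 - l ^+ 2 * lg p) by ring.
    by rewrite ler_wpM2l// le_max lexx orbT.
  by rewrite -lee_fin /Rintegral fineK//; exact: integrable_fin_num.
rewrite RintegralB// RintegralZl// RintegralZl// intW => h.
rewrite -[X in (- X)%E]fineK; last exact: (integrable_fin_num measurableT iell).
rewrite -EFinN lee_fin -[X in - X <= _]/(\int[nu]_p ell p).
move: (\int[nu]_p ell p) h => E; rewrite /K /c0.
have l2 : 0 < l ^+ 2 by rewrite exprn_gt0.
move: M G C (ln l) => m G' C' lnl h.
rewrite -(ler_pM2l l2).
have -> : l ^+ 2 * (m ^+ 2 * (lnl - 1 / 2) + m * G' / (2 * l ^+ 2)) =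
  l ^+ 2 * m ^+ 2 * (lnl - 1 / 2) + m * G' / 2 by field; rewrite gt_eqF.
by move: h; rewrite mulrN; move: (l ^+ 2) => l2'; nra.
Qed.

End logarithmic_energy.

(** * Exchange of integrals for a kernel whose negative part is integrable *)

Section signed_tonelli.
Local Open Scope ereal_scope.

(** The case beyond [integralB] is an infinite integral of f, where both sides are -oo: (g - f)^+ <=
    g has a finite integral, while f <= (g - f)^- + g forces (g - f)^- to have an infinite one. *)
Lemma ge0_integralB d (T : measurableType d) (R : realType)
    (mu : {measure set T -> \bar R}) (f g : T -> \bar R) :
  measurable_fun setT f -> measurable_fun setT g ->
  (forall x, 0 <= f x) -> (forall x, 0 <= g x) -> \int[mu]_x g x < +oo ->
  \int[mu]_x (g x - f x) = \int[mu]_x g x - \int[mu]_x f x.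
Proof.
move=> mf mg f0 g0 gfin.
have ig : mu.-integrable setT g.
  apply/integrableP; split => //.
  by under eq_integral do rewrite gee0_abs//.
have [ffin|] := ltP (\int[mu]_x f x) +oo.
  apply: integralB => //; apply/integrableP; split => //.
  by under eq_integral do rewrite gee0_abs//.
rewrite leye_eq => /eqP fy.
have mB : measurable_fun setT (g \- f) by exact: emeasurable_funB.
have gf_le x : (g \- f)^\+ x <= g x.
  by rewrite funeposE ge_max g0 andbT geeDl// oppe_le0.
have f_le x : f x <= (g \- f)^\- x + g x.
  rewrite funenegE; have m0 : 0 <= maxe (- (g x - f x)) 0 by rewrite le_max lexx orbT.
  move: (f0 x) (g0 x) m0; case: (g x) => [r| |] //=; last first.
    by move=> _ _ m0; rewrite addey ?leey// gt_eqF// (lt_le_trans (ltNyr 0%R) m0).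
  case: (f x) => [s| |] //= _ _ _.
  by rewrite -EFin_max -EFinD lee_fin -lerBlDr le_max opprB lexx.
have posfin : \int[mu]_x (g \- f)^\+ x < +oo.
  apply: le_lt_trans gfin; apply: ge0_le_integral => //.
  exact: measurable_funepos.
have negoo : \int[mu]_x (g \- f)^\- x = +oo.
  have : \int[mu]_x f x <= \int[mu]_x (g \- f)^\- x + \int[mu]_x g x.
    rewrite -ge0_integralD//; last exact: measurable_funeneg.
    apply: ge0_le_integral => //.
    by apply: emeasurable_funD => //; exact: measurable_funeneg.
  rewrite fy leye_eq => /eqP; case: (\int[mu]_x (g \- f)^\- x) => //=.
  by move: gfin; case: (\int[mu]_x g x) => //.
rewrite -[LHS]/(\int[mu]_x (g \- f) x) integralE negoo fy.
by move: posfin gfin; case: (\int[mu]_x (g \- f)^\+ x) => //= [r|] _; case: (\int[mu]_x g x).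
Qed.

Context d (T : measurableType d) (R : realType).
Variable mu : {sigma_finite_measure set T -> \bar R}.
Variables (rho : T -> R) (kap : T * T -> R) (c : R).
Hypotheses (mrho : measurable_fun setT rho) (rho0 : forall x, (0 <= rho x)%R).
Hypotheses (mkap : measurable_fun setT kap) (c0 : (0 < c)%R).
Let f (p : T * T) := (rho p.1 * kap p * rho p.2)%:E.
Hypothesis fneg : \int[mu \x mu]_p f^\- p < +oo.

Let mf : measurable_fun setT f.
Proof.
apply/measurable_EFinP; apply: measurable_funM.
  by apply: measurable_funM => //; exact: (measurableT_comp mrho measurable_fst).
exact: (measurableT_comp mrho measurable_snd).
Qed.

Let h x y := (kap (x, y) * rho y)%:E.

Let mh x : measurable_fun setT (h x).
Proof.
apply/measurable_EFinP; apply: measurable_funM => //.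
exact: (measurableT_comp mkap (measurable_pair1 x)).
Qed.

Let posE x y : f^\+ (x, y) = (rho x)%:E * (h x)^\+ y.
Proof.
rewrite !funeposE /f /h /= -!EFin_max -EFinM maxr_pMr// mulr0 mulrA.
by [].
Qed.

Let negE x y : f^\- (x, y) = (rho x)%:E * (h x)^\- y.
Proof.
rewrite !funenegE /f /h /= -!EFin_max -EFinM maxr_pMr// mulr0 mulrN mulrA.
by [].
Qed.

Let Px x := \int[mu]_y f^\+ (x, y).
Let Nx x := \int[mu]_y f^\- (x, y).

Let mPx : measurable_fun setT Px.
Proof. by apply: measurable_fun_fubini_tonelli_F => //; exact: measurable_funepos. Qed.

Let mNx : measurable_fun setT Nx.
Proof. by apply: measurable_fun_fubini_tonelli_F => //; exact: measurable_funeneg. Qed.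

Let Px0 x : 0 <= Px x. Proof. exact: integral_ge0. Qed.
Let Nx0 x : 0 <= Nx x. Proof. exact: integral_ge0. Qed.

Let intP : \int[mu]_x Px x = \int[mu \x mu]_p f^\+ p.
Proof. by rewrite fubini_tonelli1//; exact: measurable_funepos. Qed.

Let intN : \int[mu]_x Nx x = \int[mu \x mu]_p f^\- p.
Proof. by rewrite fubini_tonelli1//; exact: measurable_funeneg. Qed.

(** It moves rho x into the inner integral. With [Nx x] finite, no difference of infinities arises
    when rho x > 0. *)
Let slice x : Nx x < +oo ->
  (rho x)%:E * ((- c^-1)%:E * \int[mu]_y h x y) = (c^-1)%:E * Nx x - (c^-1)%:E * Px x.
Proof.
have PE : Px x = (rho x)%:E * \int[mu]_y (h x)^\+ y.
  rewrite /Px; under eq_integral do rewrite posE.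
  by rewrite ge0_integralZl//; [exact: measurable_funepos|rewrite lee_fin].
have NE : Nx x = (rho x)%:E * \int[mu]_y (h x)^\- y.
  rewrite /Nx; under eq_integral do rewrite negE.
  by rewrite ge0_integralZl//; [exact: measurable_funeneg|rewrite lee_fin].
have hp0 : 0 <= \int[mu]_y (h x)^\+ y by exact: integral_ge0.
have hn0 : 0 <= \int[mu]_y (h x)^\- y by exact: integral_ge0.
rewrite PE NE [X in _ * (_ * X)]integralE.
(* If rho x = 0, the inner integrals may be infinite; both sides are 0 by the convention that 0
   times an infinity is 0. *)
have [r0|rn0] := eqVneq (rho x) 0%R; first by rewrite r0 !mul0e !mule0 sube0.
have rp : (0 < rho x)%R by rewrite lt_neqAle eq_sym rn0 rho0.
have ci : (0 < c^-1)%R by rewrite invr_gt0.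
move: hp0 hn0; case: (\int[mu]_y (h x)^\- y) => [n| |] //=; last first.
  by rewrite gt0_muley ?lte_fin// ltxx.
case: (\int[mu]_y (h x)^\+ y) => [p| |] //= _ _ _.
  by rewrite -EFinD -!EFinM -EFinD; congr EFin; ring.
rewrite addye// lt0_muley ?lte_fin ?oppr_lt0// gt0_muleNy ?lte_fin//.
by rewrite gt0_muley ?lte_fin// gt0_muley ?lte_fin// addeNy.
Qed.

Let mJ : measurable_fun setT (fun x => \int[mu]_y (kap (x, y) * rho y)%:E).
Proof.
pose H (p : T * T) := (kap p * rho p.2)%:E.
have mH : measurable_fun setT H.
  apply/measurable_EFinP; apply: measurable_funM => //.
  exact: (measurableT_comp mrho measurable_snd).
have -> : (fun x => \int[mu]_y (kap (x, y) * rho y)%:E) =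
    (fun x => \int[mu]_y H^\+ (x, y)) \- (fun x => \int[mu]_y H^\- (x, y)).
  apply/funext => x; rewrite integralE /=; congr (_ - _).
    by apply: eq_integral => y _; rewrite !funeposE.
  by apply: eq_integral => y _; rewrite !funenegE.
apply: emeasurable_funB.
  by apply: measurable_fun_fubini_tonelli_F => //; exact: measurable_funepos.
by apply: measurable_fun_fubini_tonelli_F => //; exact: measurable_funeneg.
Qed.

(** As f^+ may have an infinite integral, Tonelli's theorem is applied to f^+ and f^- separately.
    Finiteness of the second makes the subtraction meaningful, for almost every x before the outer
    integration and again after it. *)
Lemma energy_double_integral :
  c%:E * \int[mu]_x ((rho x)%:E * ((- c^-1)%:E * \int[mu]_y (kap (x, y) * rho y)%:E)) =
  - \int[mu \x mu]_p f p.
Proof.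
have ci : (0 < c^-1)%R by rewrite invr_gt0.
have Nfin : \int[mu]_x Nx x < +oo by rewrite intN.
transitivity (c%:E * \int[mu]_x ((c^-1)%:E * Nx x - (c^-1)%:E * Px x)).
  congr (_ * _); apply: ae_eq_integral => //.
  - apply: emeasurable_funM; first exact/measurable_EFinP.
    exact: measurable_funeM.
  - by apply: emeasurable_funB; exact: measurable_funeM.
  - have iN : mu.-integrable setT Nx.
      apply/integrableP; split => //.
      by under eq_integral do rewrite gee0_abs//.
    have := integrable_ae measurableT iN.
    apply: filterS => x /(_ I) Nf _; apply: slice.
    by rewrite -ge0_fin_numE.
rewrite ge0_integralB//.
- rewrite !ge0_integralZl ?lee_fin ?(ltW ci)//.
  rewrite [in RHS]integralE -intP -intN.
  have : 0 <= \int[mu]_x Nx x by exact: integral_ge0.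
  have : 0 <= \int[mu]_x Px x by exact: integral_ge0.
  move: Nfin; case: (\int[mu]_x Nx x) => //= n _.
  case: (\int[mu]_x Px x) => //= [p _ _|_ _].
    by rewrite -EFinM; congr EFin; field; rewrite gt_eqF.
  by rewrite gt0_muley ?lte_fin// -EFinM addeNy gt0_muleNy ?lte_fin.
- exact: measurable_funeM.
- exact: measurable_funeM.
- by move=> x; rewrite mule_ge0 ?lee_fin ?(ltW ci).
- by move=> x; rewrite mule_ge0 ?lee_fin ?(ltW ci).
- rewrite ge0_integralZl ?lee_fin ?(ltW ci)//.
  by rewrite lte_mul_pinfty ?lee_fin ?(ltW ci).
Qed.

End signed_tonelli.

(** * Norms of u and its gradient, and the modulus of u *)

Section L2norm.
Variable R : realType.
Local Notation mu := (@lebesgue2 R).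
Local Notation T1 := (measurableTypeR R).
Local Notation T2 := (T1 * T1)%type.

Lemma L2norm_sqr (f : T2 -> R) : mu.-integrable setT (fun x => (f x ^+ 2)%:E) ->
  L2norm f ^+ 2 = \int[mu]_x (f x ^+ 2).
Proof.
move=> f2; rewrite /L2norm unlock.
have -> : (\int[mu]_x `|(EFin \o f) x| `^ 2 = (\int[mu]_x (f x ^+ 2))%:E)%E.
  rewrite /Rintegral fineK; last exact: integrable_fin_num.
  apply: eq_integral => x _ /=; rewrite -[2]/(2%:R) powR_mulrn//.
  by rewrite real_normK ?num_real.
rewrite poweR_EFin /= powR12_sqrt; first by rewrite sqr_sqrtr// Rintegral_ge0// => x _;
  exact: sqr_ge0.
by apply: Rintegral_ge0 => x _; exact: sqr_ge0.
Qed.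

Lemma L2norm_ge0 (f : T2 -> R) : 0 <= L2norm f.
Proof. by rewrite fine_ge0// Lnorm_ge0. Qed.

End L2norm.

Section modulus.
Variables (R : realType) (u : R * R -> R[i]).
Hypothesis uH1 : H1 u.
Local Notation mu := (@lebesgue2 R).
Local Notation T1 := (measurableTypeR R).
Local Notation T2 := (T1 * T1)%type.

Let a (x : T2) : R := complex.Re (u x).
Let b (x : T2) : R := complex.Im (u x).
Let ga i : T2 -> R := weak_partial i a.
Let gb i : T2 -> R := weak_partial i b.
Let w (x : T2) : R := Normc.normc (u x).
Let g i : R := \int[mu]_x (ga i x ^+ 2) + \int[mu]_x (gb i x ^+ 2).

Let a2 : a \in Lfun mu 2%:E. Proof. by have [[]] := uH1. Qed.
Let b2 : b \in Lfun mu 2%:E. Proof. by have [_ []] := uH1. Qed.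

Let gaP i : ga i \in Lfun mu 2%:E /\ is_weak_partial i a (ga i).
Proof. by have [[_ /(_ i)[v v_]] _] := uH1; exact: (xgetPex (cst 0) (ex_intro _ v v_)). Qed.

Let gbP i : gb i \in Lfun mu 2%:E /\ is_weak_partial i b (gb i).
Proof. by have [_ [_ /(_ i)[v v_]]] := uH1; exact: (xgetPex (cst 0) (ex_intro _ v v_)). Qed.

Let Lfun_meas (f : T2 -> R) : f \in Lfun mu 2%:E -> measurable_fun setT f.
Proof. by rewrite inE => /andP[/[!inE]]. Qed.

Let w2E x : w x ^+ 2 = a x ^+ 2 + b x ^+ 2.
Proof.
rewrite /w /a /b; case: (u x) => p q /=.
by rewrite sqr_sqrtr// addr_ge0 ?sqr_ge0.
Qed.

Let wE x : w x = Num.sqrt (a x ^+ 2 + b x ^+ 2).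
Proof. by rewrite /w /a /b; case: (u x). Qed.

Lemma measurable_normc_H1 : measurable_fun setT w.
Proof.
rewrite (_ : w = Num.sqrt \o (fun x => a x ^+ 2 + b x ^+ 2)); last first.
  by apply/funext => x; rewrite /= -wE.
apply: (measurableT_comp (@measurable_sqrt R)).
by apply: measurable_funD; apply: measurable_funX; exact: Lfun_meas.
Qed.

Lemma integrable_normc_H1 : mu.-integrable setT (fun x => (w x ^+ 2)%:E).
Proof.
have := integrableD measurableT (Lfun2_integrable_sqr a2) (Lfun2_integrable_sqr b2).
by apply: eq_integrable => // x _; rewrite w2E EFinD.
Qed.

(** The reverse triangle inequality in the plane, with Cauchy-Schwarz from Lagrange's identity. It
    bounds the differences of |u| by those of Re u and Im u. *)
Let normB_le (p q r s : R) :
  (Num.sqrt (p ^+ 2 + q ^+ 2) - Num.sqrt (r ^+ 2 + s ^+ 2)) ^+ 2 <=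
  (p - r) ^+ 2 + (q - s) ^+ 2.
Proof.
have pq : 0 <= p ^+ 2 + q ^+ 2 by rewrite addr_ge0 ?sqr_ge0.
have rs : 0 <= r ^+ 2 + s ^+ 2 by rewrite addr_ge0 ?sqr_ge0.
have CS : p * r + q * s <= Num.sqrt (p ^+ 2 + q ^+ 2) * Num.sqrt (r ^+ 2 + s ^+ 2).
  rewrite -sqrtrM// (le_trans (ler_norm _))// -sqrtr_sqr ler_wsqrtr// -subr_ge0.
  have -> : (p ^+ 2 + q ^+ 2) * (r ^+ 2 + s ^+ 2) - (p * r + q * s) ^+ 2 =
    (p * s - q * r) ^+ 2 by ring.
  exact: sqr_ge0.
rewrite sqrrB !sqr_sqrtr// -mulr_natl; lra.
Qed.

Lemma normc_difference_quotient i (k : R) : 0 < k ->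
  (\int[mu]_x ((w (x + k *: axis R i) - w x) ^+ 2)%:E <= (k ^+ 2 * g i)%:E)%E.
Proof.
move=> k0.
have mw := measurable_normc_H1.
have ms (f : T2 -> R) : measurable_fun setT f ->
    measurable_fun setT (fun x : T2 => (f (x + k *: axis R i) - f x) ^+ 2).
  move=> mf; apply: measurable_funX; apply: measurable_funB => //.
  exact: (measurableT_comp mf (measurable_shift _)).
have [ga2 gaw] := gaP i; have [gb2 gbw] := gbP i.
have fin (f : T2 -> R) : f \in Lfun mu 2%:E ->
    ((k ^+ 2)%:E * \int[mu]_x (f x ^+ 2)%:E = (k ^+ 2 * \int[mu]_x (f x ^+ 2))%:E)%E.
  move=> f2; rewrite [RHS]EFinM; congr (_ * _)%E; apply/esym/fineK.
  exact/(integrable_fin_num measurableT)/Lfun2_integrable_sqr.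
have := weak_difference_quotient k0 a2 ga2 gaw; rewrite (fin _ ga2) => Da.
have := weak_difference_quotient k0 b2 gb2 gbw; rewrite (fin _ gb2) => Db.
rewrite /g.
apply: (@le_trans _ _ (\int[mu]_x (((a (x + k *: axis R i) - a x) ^+ 2)%:E +
    ((b (x + k *: axis R i) - b x) ^+ 2)%:E))%E).
  apply: ge0_le_integral => //.
  - by move=> x _; rewrite lee_fin sqr_ge0.
  - by apply/measurable_EFinP; exact: ms.
  - by apply: emeasurable_funD; apply/measurable_EFinP; apply: ms; exact: Lfun_meas.
  - by move=> x _; rewrite -EFinD lee_fin !wE.
rewrite ge0_integralD//; last 4 first.
- by move=> x _; rewrite lee_fin sqr_ge0.
- by apply/measurable_EFinP; apply: ms; exact: Lfun_meas.
- by move=> x _; rewrite lee_fin sqr_ge0.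
- by apply/measurable_EFinP; apply: ms; exact: Lfun_meas.
apply: (le_trans (leeD Da Db)).
move: (\int[mu]_x (ga i x ^+ 2)) (\int[mu]_x (gb i x ^+ 2)) => A B.
by rewrite -EFinD -mulrDr.
Qed.

Let grad2E x : grad_abs u x ^+ 2 = \sum_(i < 2) (ga i x ^+ 2 + gb i x ^+ 2).
Proof.
rewrite /grad_abs sqr_sqrtr; last by apply: sumr_ge0 => i _; exact: sqr_ge0.
apply: eq_bigr => i _; rewrite /cabs2 /= sqr_sqrtr//.
by rewrite addr_ge0 ?sqr_ge0.
Qed.

Lemma L2norm_grad_sqr : L2norm (grad_abs u) ^+ 2 = \sum_(i < 2) g i.
Proof.
have ig i : mu.-integrable setT (EFin \o (fun x => ga i x ^+ 2 + gb i x ^+ 2)).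
  have := integrableD measurableT (Lfun2_integrable_sqr (gaP i).1) (Lfun2_integrable_sqr (gbP i).1).
  by apply: eq_integrable.
rewrite L2norm_sqr; last first.
  have := integrableD measurableT (ig ord0) (ig (lift ord0 ord0)).
  by apply: eq_integrable => // x _; rewrite grad2E big_ord_recl big_ord1.
transitivity (\int[mu]_x ((ga ord0 x ^+ 2 + gb ord0 x ^+ 2) +
   (ga (lift ord0 ord0) x ^+ 2 + gb (lift ord0 ord0) x ^+ 2))).
  by apply: eq_Rintegral => x _; rewrite grad2E big_ord_recl big_ord1.
rewrite RintegralD// big_ord_recl big_ord1 /g; congr (_ + _).
  by rewrite RintegralD//; apply: Lfun2_integrable_sqr; [exact: (gaP _).1|exact: (gbP _).1].
by rewrite RintegralD//; apply: Lfun2_integrable_sqr; [exact: (gaP _).1|exact: (gbP _).1].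
Qed.

Lemma L2norm_normc_gt0 : ~ {ae mu, forall x, u x = 0} -> 0 < L2norm w.
Proof.
move=> un0; rewrite lt_neqAle L2norm_ge0 andbT eq_sym; apply/negP => /eqP w0.
apply: un0.
have : \int[mu]_x (w x ^+ 2) = 0 by rewrite -L2norm_sqr ?w0 ?expr0n//; exact: integrable_normc_H1.
have iw := integrable_normc_H1.
move=> h.
have /(ae_eq_integral_abs mu measurableT) : (\int[mu]_x `|(w x ^+ 2)%:E| = 0)%E.
  under eq_integral do rewrite gee0_abs ?lee_fin ?sqr_ge0//.
  by rewrite -[LHS]fineK; [rewrite [X in X%:E](h : _ = _)|exact: integrable_fin_num].
move=> /(_ (measurable_int _ iw)).
apply: (@filterS _ _ (ae_filter_ringOfSetsType mu)) => x /(_ I) [].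
rewrite w2E => /eqP; rewrite paddr_eq0 ?sqr_ge0// !sqrf_eq0 => /andP[/eqP ax /eqP bx].
by move: ax bx; rewrite /a /b; case: (u x) => p q /= -> ->.
Qed.

End modulus.

Theorem proposition9 (R : realType) (u : R * R -> R[i]) (uH1 : H1 u)
    (u_neq0 : ~ {ae @lebesgue2 R, forall x, u x = 0}) :
  let normu := L2norm (fun x => Normc.normc (u x)) in
  let normgradu := L2norm (grad_abs u) in
  let rho := fun x => cabs2 (u x) in
  let energy := ((2 * pi)%:E *
    \int[@lebesgue2 R]_x ((rho x)%:E * inv_neg_laplacian rho x))%E in
  (energy <= (normu ^+ 4 * ln (normgradu / normu))%:E)%E /\
  (energy = - \int[@lebesgue2 R \x @lebesgue2 R]_z
    (rho z.1 * ln (enorm (z.1 - z.2)) * rho z.2)%:E)%E.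
Proof.
move=> normu normgradu rho energy.
have mw := measurable_normc_H1 uH1.
have w2 := integrable_normc_H1 uH1.
have wg := normc_difference_quotient uH1.
have M2 := L2norm_sqr w2.
have G2 := L2norm_grad_sqr uH1.
have nu0 : 0 < normu := L2norm_normc_gt0 uH1 u_neq0.
have ng0 : 0 <= normgradu := L2norm_ge0 _.
have energyE : energy = (- \int[@lebesgue2 R \x @lebesgue2 R]_z
    (rho z.1 * ln (enorm (z.1 - z.2)) * rho z.2)%:E)%E.
  apply: (@energy_double_integral _ _ R (@lebesgue2 R) rho
      (fun z => ln (enorm (z.1 - z.2))) (2 * pi)).
  - exact: measurable_funX.
  - by move=> x; exact: sqr_ge0.
  - exact: measurable_ln_distance.
  - by rewrite mulr_gt0// pi_gt0.
  (* Finiteness of the negative part can be read off at any scale; l = 1 is taken. *)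
  - exact: (log_energy_neg_lty mw w2 wg ltr01).
split => //; rewrite energyE.
have le_l l (l0 : 0 < l) := log_energy_le mw w2 wg l0.
rewrite -M2 -G2 -/normu -/normgradu in le_l.
move: ng0; rewrite le_eqVlt => /predU1P[ng|ng0].
  (* Here ln (normgradu / normu) is the junk value ln 0 = 0. *)
  apply: (le_trans (le_l 1 ltr01)); rewrite lee_fin -ng ln1 expr0n /= mul0r ln0//.
  by rewrite !mulr0 mul0r addr0 sub0r mulrN oppr_le0 mulr_ge0// sqr_ge0.
(* At this l the kinetic term M G / (2 l^2) equals M^2 / 2 and cancels the constant term exactly,
   which is why the field had to reach the value 1/2. *)
have l0 : 0 < normgradu / normu by rewrite divr_gt0.
apply: (le_trans (le_l _ l0)); rewrite lee_fin le_eqVlt; apply/orP; left; apply/eqP.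
by field; rewrite !gt_eqF.
Qed.
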